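(* Let $(X_t)_{t\in J}$ be a centered continuous additive process, represented as $X_t=B_{V(t)}$, and suppose that $V$ is strictly increasing on $J$. Suppose that $T=V^{-1}:V(J)\to J$ admits a point $s\in V(J)$ at which its upper local uniform Hölder index is positive. Then, almost surely, the graph $\mathcal{G}(X,J)$ has positive Fourier dimension.
   Context: $J=[0,S]$ with $0<S\le\infty$ (meaning $[0,\infty)$ if $S=\infty$). A real-valued process $(X_t)_{t\in J}$ is an additive process if it has independent increments, $X_0=0$ almost surely, and it is continuous in probability. It is a continuous additive process if moreover its sample paths are almost surely continuous, and it is centered if $\mathbb{E}[X_t]=0$ for all $t$. A centered continuous additive process can be represented as $X_t=B_{V(t)}$, where $B$ is a standard Brownian motion with $B_0=0$ and $V(t)=\mathbb{E}[X_t^2]$ is a continuous nondecreasing function on $J$ with $V(0)=0$. The graph is $\mathcal{G}(X,E)=\{(t,X_t):t\in E\}\subset\mathbb{R}^2$. Upper local uniform Hölder index: for a strictly increasing function $F$ on an interval $L$ and $s\in L$, it is $$\sup\Big\{\alpha\in[0,\infty):\lim_{\delta\to0}\ \sup_{u_1\ne u_2\in I(s,\delta)\cap L}\frac{|F(u_1)-F(u_2)|}{|u_1-u_2|^{\alpha}}=0\Big\},$$ where $I(s,\delta)$ is the open interval of length $\delta$ centered at $s$. Fourier dimension: for a Borel set $E\subset\mathbb{R}^2$, $\dim_F E$ is the supremum of all $\alpha\ge0$ for which there is a nonzero finite Borel measure $\mu$ supported on $E$ and a constant $C$ with $|\widehat\mu(\xi)|\le C|\xi|^{-\alpha/2}$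 for all $\xi\neq0$, where $\widehat\mu(\xi)=\int e^{-2\pi i\xi\cdot x}\,d\mu(x)$. *)

(* Defs.v *)
From HB Require Import structures.
From mathcomp Require Import all_boot all_order all_algebra.
From mathcomp Require Import all_classical all_reals all_analysis.
From mathcomp Require Import complex.

Set Implicit Arguments.
Unset Strict Implicit.
Unset Printing Implicit Defensive.

Import Order.TTheory GRing.Theory Num.Theory.
Import numFieldNormedType.Exports.

Local Open Scope classical_set_scope.
Local Open Scope ring_scope.

(* [0, S], read as [0, +oo[ when S = +oo. *)
Definition time_set (R : realType) (S : \bar R) : set R :=
  [set t | 0 <= t /\ (t%:E <= S)%E].

(* Letting some A i be setT recovers the product rule for every subfamily. *)
Definition mutually_independent d (Omega : measurableType d) (R : realType)
    (P : probability Omega R) n (Y : 'I_n -> Omega -> R) :=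
  forall A : 'I_n -> set R, (forall i, measurable (A i)) ->
    P (\bigcap_(i in [set: 'I_n]) (Y i @^-1` A i))
    = (\prod_(i < n) P (Y i @^-1` A i))%E.

(* A real-valued process indexed by J is a family X : R -> {RV P >-> R} whose
   values X t are only ever constrained for t in J. *)

Definition independent_increments d (Omega : measurableType d) (R : realType)
    (P : probability Omega R) (J : set R) (X : R -> {RV P >-> R}) :=
  forall n (t : nat -> R),
    (forall i, (i <= n)%N -> J (t i)) ->
    (forall i, (i < n)%N -> t i <= t i.+1) ->
    mutually_independent P
      (fun (i : 'I_n) (w : Omega) => X (t i.+1) w - X (t i) w).
Arguments independent_increments {d Omega R} P J X.

Definition continuous_in_probability d (Omega : measurableType d)
    (R : realType) (P : probability Omega R) (J : set R)
    (X : R -> {RV P >-> R}) :=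
  forall t, J t -> forall eps : R, 0 < eps ->
    P [set w | eps < `|X u w - X t w|] @[u --> within J (nbhs t)] --> 0%E.
Arguments continuous_in_probability {d Omega R} P J X.

Definition continuous_paths d (Omega : measurableType d) (R : realType)
    (P : probability Omega R) (J : set R) (X : R -> {RV P >-> R}) :=
  {ae P, forall w, {within J, continuous (fun t => X t w)}}.
Arguments continuous_paths {d Omega R} P J X.

Record additive_process d (Omega : measurableType d) (R : realType)
    (P : probability Omega R) (J : set R) (X : R -> {RV P >-> R}) : Prop := {
  additive_indep : independent_increments P J X ;
  additive_start : {ae P, forall w, X 0 w = 0} ;
  additive_cvg : continuous_in_probability P J X }.
Arguments additive_process {d Omega R} P J X.

Record continuous_additive_process d (Omega : measurableType d) (R : realType)
    (P : probability Omega R) (J : set R) (X : R -> {RV P >-> R}) : Prop := {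
  continuous_additive : additive_process P J X ;
  continuous_additive_paths : continuous_paths P J X }.
Arguments continuous_additive_process {d Omega R} P J X.

Definition centered_process d (Omega : measurableType d) (R : realType)
    (P : probability Omega R) (J : set R) (X : R -> {RV P >-> R}) :=
  forall t, J t ->
    P.-integrable setT (EFin \o X t) /\ ('E_P[X t] = 0)%E.
Arguments centered_process {d Omega R} P J X.

(* Standard Brownian motion restricted to an index set I of nonnegative times
   containing 0; I = [0, +oo[ gives the usual notion. The second parameter of
   normal_prob is the standard deviation. *)
Record standard_brownian_motion d (Omega : measurableType d) (R : realType)
    (P : probability Omega R) (I : set R) (B : R -> {RV P >-> R}) : Prop := {
  brownian_start : {ae P, forall w, B 0 w = 0} ;
  brownian_indep : independent_increments P I B ;
  brownian_increment : forall s t, I s -> I t -> s < t ->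
    forall A : set R, measurable A ->
      P ((fun w => B t w - B s w) @^-1` A)
      = normal_prob 0 (Num.sqrt (t - s)) A ;
  brownian_paths : continuous_paths P I B }.
Arguments standard_brownian_motion {d Omega R} P I B.

(* X_t = B_{V(t)} only involves B on V(J). Asking B to be a Brownian motion on
   that index set, rather than on [0, +oo[, does not presuppose that Omega is
   rich enough to carry a continuation of B past the range of V. *)
Record brownian_representation d (Omega : measurableType d) (R : realType)
    (P : probability Omega R) (J : set R) (X : R -> {RV P >-> R})
    (V : R -> R) (B : R -> {RV P >-> R}) : Prop := {
  variance_function : forall t, J t ->
    ((V t)%:E = 'E_P[fun w => (X t w ^+ 2)%R])%E ;
  variance_start : V 0 = 0 ;
  variance_continuous : {within J, continuous V} ;
  variance_nondecreasing : {in J &, {homo V : s t / s <= t}} ;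
  represented_brownian : standard_brownian_motion P (V @` J) B ;
  represented_eq : forall t, J t -> {ae P, forall w, X t w = B (V t) w} }.
Arguments brownian_representation {d Omega R} P J X V B.

Definition graph (R : realType) (f : R -> R) (E : set R) : set (R * R) :=
  [set (t, f t) | t in E].

(* sup over u1 != u2 in I(s, delta) `&` L of |F u1 - F u2| / |u1 - u2|^alpha,
   where I(s, delta) has length delta. *)
Definition holder_quotient_sup (R : realType) (F : R -> R) (L : set R)
    (s alpha delta : R) : \bar R :=
  ereal_sup [set q | exists u1 u2,
    [/\ u1 \in `]s - delta / 2, s + delta / 2[, L u1,
        u2 \in `]s - delta / 2, s + delta / 2[, L u2 &
        u1 != u2 /\ q = (`|F u1 - F u2| / `|u1 - u2| `^ alpha)%:E]].

Definition upper_local_uniform_holder_index (R : realType) (F : R -> R)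
    (L : set R) (s : R) : \bar R :=
  ereal_sup [set alpha%:E | alpha in [set alpha : R | 0 <= alpha /\
    holder_quotient_sup F L s alpha delta @[delta --> 0^'+] --> 0%E]].

(* The norm of R * R in the library is the sup norm. *)
Definition euclidean_norm (R : realType) (x : R * R) : R :=
  Num.sqrt (x.1 ^+ 2 + x.2 ^+ 2).

Definition dot_product (R : realType) (x y : R * R) : R :=
  x.1 * y.1 + x.2 * y.2.

(* The integral of exp(-2 pi i xi.x), by real and imaginary parts. *)
Definition fourier_transform (R : realType)
    (mu : {finite_measure set (R * R)%type -> \bar R}) (xi : R * R) : R[i] :=
  Complex (\int[mu]_x cos (2 * pi * dot_product xi x))
          (- \int[mu]_x sin (2 * pi * dot_product xi x)).

(* mu is supported on E when the complement of E is mu-negligible, that is,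
   mu (~` E) = 0 when E is a Borel set. *)
Definition fourier_decay (R : realType) (E : set (R * R)) (alpha : R) :=
  exists2 mu : {finite_measure set (R * R)%type -> \bar R},
    mu setT != 0%E /\ mu.-negligible (~` E) &
    exists C : R, forall xi : R * R, xi != 0 ->
      ComplexField.Normc.normc (fourier_transform mu xi)
      <= C * euclidean_norm xi `^ (- (alpha / 2)).

Definition fourier_dim (R : realType) (E : set (R * R)) : \bar R :=
  ereal_sup [set alpha%:E | alpha in
    [set alpha : R | 0 <= alpha /\ fourier_decay E alpha]].

(* Main.v *)
Require Import Defs.
From HB Require Import structures.
From mathcomp Require Import all_boot all_order all_algebra.
From mathcomp Require Import all_classical all_reals all_analysis.
From mathcomp Require Import measurable_realfun complex ring lra zify.

Set Implicit Arguments.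
Unset Strict Implicit.
Unset Printing Implicit Defensive.

Import Order.TTheory GRing.Theory Num.Theory.
Import numFieldNormedType.Exports.

Local Open Scope classical_set_scope.
Local Open Scope ring_scope.

(** Why the graph carries a measure whose Fourier transform decays polynomially.

The Holder condition on [T] near [s] says that [V] grows at least like a power
on some interval from [a] to [a + h]: [V t - V s >= (t - s) ^ q]. Rescale it to
[[0, 1]], put [Y_u = X_(a + h u) - X_a], and push Lebesgue measure on [[0, 1]]
forward to the graph. Up to a phase, its Fourier transform is the integral of
[exp (i (x u + y Y_u))] over [[0, 1]], called [wave] below, where [(x, y)] is a
fixed linear image of the frequency. It is enough to bound this integral by
[K / N], with [K] random, when the larger of [|x|], [|y|] lies between [N ^ Q]
and [(N + 1) ^ Q]. Lebesgue measure in the time variable is the right choice: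
the image under [T] of Lebesgue measure in the Brownian clock may have no decay
at frequencies [(x, 0)] when [V] is singular.

If [|y| >= N ^ p], randomness does the work ([high_frequency_bound]). Cut
[[0, 1]] into [N ^ 3] blocks. Conditionally on the past, the average of
[cos (c + x u + y Y_u)] over a block is of order [1 / N]: increments over a lag
[r] are Gaussian with variance at least of order [r ^ q], and the characteristic
function of a Gaussian of standard deviation [sigma] at [y] is at most
[2 pi / (|y| sigma)] ([normal_prob_cos_le]). Multiplying exponential moments
block by block, as in the inequality of Azuma and Hoeffding, gives
[exp_block_sum_le], a bound exponential in [N]; it beats the number of points of
a lattice of frequencies, which is polynomial in [N], and the integral is
Lipschitz in the frequency.

If [|y| < N ^ p], then [|x| >= N ^ Q] is much larger ([low_frequency_bound],
[low_wave_le]). Freeze [Y] at the left end of each of [N ^ (2 (p + 3))] blocks: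
each frozen block contributes at most [2 / |x|], and the error is [|y|] times
the mean displacement of [Y] inside its block. No modulus of continuity of [V]
is available, but [V] is monotone, so the variances of the displacements over
the blocks telescope, and the expected mean displacement is small.

Expectations are computed for Riemann sums, which see finitely many times only.
They pass to the integrals by Fatou's lemma, and summability over [N] makes the
random constants finite ([ae_bounded_of_summable_expectation]). *)

(** * Integrals of continuous functions over segments *)

Section real_analysis.
Context {R : realType}.
Implicit Types (F f : R -> R) (u v d c x y : R).
Notation mu := (@lebesgue_measure R).

Lemma cos_lipschitz x y : `|cos x - cos y| <= `|x - y|.
Proof.
wlog xy : x y / x <= y => [H|].
  have [/H//|/ltW/H] := leP x y.
  by rewrite distrC [X in _ <= X]distrC.
have [] := @MVT_segment R cos (fun t => - sin t) x y xy.
- by apply: continuous_subspaceT; exact: continuous_cos.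
move=> c _ E; rewrite distrC E normrM normrN [X in _ <= X]distrC.
by rewrite ler_piMl// sin_max.
Qed.

Lemma continuous_integrable F u v : continuous F ->
  mu.-integrable `[u, v] (EFin \o F).
Proof.
move=> cF; apply: continuous_compact_integrable; first exact: segment_compact.
exact: continuous_subspaceT.
Qed.
Hint Resolve continuous_integrable : core.

Lemma Rintegral_cst_itv u v c : u <= v ->
  \int[mu]_(t in `[u, v]) c = c * (v - u).
Proof.
move=> uv; rewrite Rintegral_cst//= lebesgue_measure_itv/= lte_fin.
by rewrite le_eqVlt in uv; case: ltP uv => //; case: eqP => // ->;
    rewrite subrr.
Qed.

Lemma le_norm_Rintegral_itv F u v c : u <= v -> continuous F ->
  (forall t, u <= t <= v -> `|F t| <= c) ->
  `|\int[mu]_(t in `[u, v]) F t| <= c * (v - u).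
Proof.
move=> uv cF Fc; rewrite -(Rintegral_cst_itv _ uv).
apply: le_trans (le_normr_Rintegral _ _) _ => //;
    first exact: continuous_integrable.
apply: le_Rintegral => //.
- by apply: continuous_integrable => t; apply: cvg_norm; exact: cF.
- by apply: continuous_integrable => t; exact: cvg_cst.
Qed.

Lemma Rintegral_itv_split F u v z : u <= v -> v <= z -> continuous F ->
  \int[mu]_(t in `[u, z]) F t =
  \int[mu]_(t in `[u, v]) F t + \int[mu]_(t in `[v, z]) F t.
Proof.
move=> uv vz cF.
have := @Rintegral_itvB R F (BLeft u) (BRight z) v (continuous_integrable _ _
    cF).
rewrite !bnd_simp => /(_ uv vz) /eqP; rewrite subr_eq => /eqP ->.
rewrite addrC Rintegral_itv_obnd_cbnd//.
by apply: integrableS (continuous_integrable _ _ cF) => //;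
  apply: subset_itv; rewrite bnd_simp.
Qed.

Lemma Rintegral_itv_sum F u d n : 0 <= d -> continuous F ->
  \int[mu]_(t in `[u, u + n%:R * d]) F t =
  \sum_(k < n) \int[mu]_(t in `[u + k%:R * d, u + k.+1%:R * d]) F t.
Proof.
move=> d0 cF; elim: n => [|n IH].
  by rewrite big_ord0 mul0r addr0 set_itv1 Rintegral_set1.
rewrite big_ord_recr/= -IH; apply: Rintegral_itv_split => //.
  by rewrite lerDl mulr_ge0.
by rewrite lerD2l ler_wpM2r// ler_nat.
Qed.

Lemma segment_unif_continuous F u v e : continuous F -> 0 < e ->
  exists2 d, 0 < d & forall x y, u <= x <= v -> `|x - y| < d -> `|F x - F y| <
      e.
Proof.
move=> cF e0.
have := @segment_compact R u v.
move=> /compact_near_coveringP /(_ R 0^'+ (fun d x => forall y,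
  `|x - y| < d -> `|F x - F y| < e)) H.
have : \forall d \near 0^'+, `[u, v] `<=` (fun x => forall y, `|x - y| < d ->
    `|F x - F y| < e).
  apply: H => x _.
  have /cvgrPdist_lt /(_ (e / 2)) := cF x; rewrite divr_gt0// => /(_ isT).
  case/nbhs_ballP => r /= r0 Hr.
  exists (ball x (r / 2), [set d | 0 < d < r / 2]) => /=.
    split; first by apply: nbhsx_ballx; rewrite divr_gt0.
    near=> d; apply/andP; split; near: d; first exact: nbhs_right_gt.
    by apply: nbhs_right_lt; rewrite divr_gt0.
  move=> [x' d] /= [xx' /andP[d0 dr]] y x'y.
  have h1 : `|F x - F x'| < e / 2.
    apply: Hr; rewrite /ball/=; move: xx'; rewrite /ball/= => xx'; lra.
  have h2 : `|F x - F y| < e / 2.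
    apply: Hr; rewrite /ball/=; move: xx'; rewrite /ball/= => xx'.
    have -> : x - y = (x - x') + (x' - y) by ring.
    by apply: le_lt_trans (ler_normD _ _) _; lra.
  have -> : F x' - F y = (F x - F y) - (F x - F x') by ring.
  by apply: le_lt_trans (ler_normB _ _) _; lra.
move=> H'; have [d [d0 Hd]] : exists d : R, 0 < d /\ `[u, v] `<=` (fun x =>
    forall y, `|x - y| < d -> `|F x - F y| < e).
  apply: (@filter_ex _ (0^'+ : set_system R)); near=> d; split.
    by near: d; exact: nbhs_right_gt.
  by near: d; exact: H'.
by exists d => // x y xuv; apply: Hd; rewrite /= in_itv.
Unshelve. all: by end_near.
Qed.

(** Both sides split over the same subdivision, and the integrand is uniformly
    continuous on the segment. *)
Lemma riemann_sum_cvg F u d : 0 <= d -> continuous F ->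
  (m.+1%:R^-1 * \sum_(k < m.+1) F (u + k%:R * (d / m.+1%:R))) * d @[m --> \oo]
      -->
  \int[mu]_(t in `[u, u + d]) F t.
Proof.
move=> d0 cF; apply/cvgrPdist_le => e e0.
have e'0 : 0 < e / (d + 1) by rewrite divr_gt0//; lra.
have [r r0 Hr] := segment_unif_continuous u (u + d) cF e'0.
near=> m.
have m0 : (0 : R) < m.+1%:R by rewrite ltr0n.
set h := d / m.+1%:R.
have h0 : 0 <= h by rewrite divr_ge0// ltW.
have hr : h < r.
  rewrite ltr_pdivrMr//.
  near: m; exists (Num.truncn (d / r)).+1 => //= m /= hm.
  rewrite mulrC -ltr_pdivrMr//; apply: lt_le_trans (truncnS_gt _) _.
  by rewrite ler_nat; exact: leqW.
have dE : d = m.+1%:R * h by rewrite /h mulrC divfK// gt_eqF.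
have -> : u + d = u + m.+1%:R * h by rewrite -dE.
rewrite Rintegral_itv_sum// [X in _ - X]mulrC mulrA -/h mulr_sumr -sumrB.
apply: le_trans (ler_norm_sum _ _ _) _.
apply: (@le_trans _ _ (\sum_(k < m.+1) (e / (d + 1)) * h)).
  apply: ler_sum => k _.
  have kk : u + k.+1%:R * h - (u + k%:R * h) = h.
    by rewrite -addn1 natrD; ring.
  have kle : u + k%:R * h <= u + k.+1%:R * h by rewrite lerD2l ler_wpM2r//
      ler_nat.
  have -> : h * F (u + k%:R * h) = \int[mu]_(t in `[u + k%:R * h, u + k.+1%:R *
      h]) F (u + k%:R * h).
    by rewrite Rintegral_cst_itv// kk mulrC.
  have cc : continuous (fun _ : R => F (u + k%:R * h)) by exact: cst_continuous.
  rewrite -RintegralB//; [|exact: continuous_integrable|exact: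
      continuous_integrable].
  rewrite -[X in _ <= _ * X]kk; apply: le_norm_Rintegral_itv => //.
    by move=> t; apply: cvgB; [exact: cF|exact: cvg_cst].
  move=> t /andP[t1 t2]; apply/ltW/Hr.
    apply/andP; split.
      by apply: le_trans t1; rewrite lerDl mulr_ge0.
    apply: (le_trans t2); rewrite lerD2l [X in _ <= X]dE ler_wpM2r// ler_nat.
    exact: ltn_ord.
  rewrite ger0_norm ?subr_ge0//; apply: le_lt_trans hr.
  by rewrite -[X in _ <= X]kk lerD2r.
rewrite sumr_const card_ord -mulr_natl mulrCA -dE.
rewrite mulrAC ler_pdivrMr; last by lra.
by rewrite ler_pM2l//; lra.
Unshelve. all: by end_near.
Qed.

(** The primitive [sin (c + x t) / x] is bounded by [1 / |x|], whatever the
    segment. *)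
Lemma norm_Rintegral_cos_le c x u v : x != 0 -> u <= v ->
  `|\int[mu]_(t in `[u, v]) cos (c + x * t)| <= 2 / `|x|.
Proof.
move=> x0; rewrite le_eqVlt => /predU1P[->|uv].
  by rewrite set_itv1 Rintegral_set1 normr0 divr_ge0.
pose G t := sin (c + x * t) / x.
have dG (t : R) : is_derive t (1 : R) G (cos (c + x * t)).
  rewrite /G; apply: is_derive_eq.
  by rewrite /GRing.scale/=; field.
have cG : continuous G.
  by move=> t; apply/differentiable_continuous/derivable1_diffP/ex_derive.
have cC : continuous (fun t => cos (c + x * t)).
  move=> t; apply: continuous_comp; last exact: continuous_cos.
  by apply: cvgD; [exact: cvg_cst|apply: cvgM; [exact: cvg_cst|exact: cvg_id]].
rewrite /Rintegral (@continuous_FTC2 _ _ G)//=.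
- rewrite /G -mulrBl normrM normfV ler_wpM2r ?invr_ge0//.
  apply: le_trans (ler_normB _ _) _; have := @sin_max R (c + x * v).
  by have := @sin_max R (c + x * u); lra.
- exact: continuous_subspaceT.
- split.
  + by move=> t _; apply: ex_derive.
  + by apply: cvg_at_right_filter; exact: cG.
  + by apply: cvg_at_left_filter; exact: cG.
- by move=> t _; rewrite derive1E derive_val.
Qed.

End real_analysis.
#[local] Hint Resolve continuous_integrable : core.

(** * Gaussian integrals *)

Section gaussian.
Context {R : realType}.
Implicit Types (s m c x y : R).
Notation mu := (@lebesgue_measure R).

(** The normal law is defined by integrating its density over sets; uniqueness
    of the Radon-Nikodym derivative turns this into a change of measure for
    functions. *)
Lemma normal_prob_Radon_Nikodym_ae_eq m s :
  ae_eq mu setT (Radon_Nikodym_SigmaFinite.f (normal_prob m s) mu)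
    (EFin \o normal_pdf m s).
Proof.
have dom := normal_prob_dominates m s.
apply: integral_ae_eq => //.
- exact: Radon_Nikodym_SigmaFinite.f_integrable.
- by apply/measurable_EFinP; exact: measurable_normal_pdf.
- move=> A _ mA; rewrite -Radon_Nikodym_SigmaFinite.f_integral//.
Qed.

Lemma ge0_integral_normal_prob m s (f : R -> \bar R) :
  measurable_fun setT f -> (forall x, 0 <= f x)%E ->
  (\int[normal_prob m s]_x f x = \int[mu]_x (f x * (normal_pdf m s x)%:E))%E.
Proof.
move=> mf f0; have dom := normal_prob_dominates m s.
rewrite -(Radon_Nikodym_SigmaFinite.change_of_variables dom)//.
apply: ae_eq_integral => //.
- apply: emeasurable_funM => //; apply: (measurable_int mu).
  exact: Radon_Nikodym_SigmaFinite.f_integrable.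
- by apply: emeasurable_funM => //; apply/measurable_EFinP;
    exact: measurable_normal_pdf.
- exact/ae_eqe_mul2l/normal_prob_Radon_Nikodym_ae_eq.
Qed.

Lemma integral_normal_prob m s (f : R -> \bar R) :
  measurable_fun setT f ->
  (\int[normal_prob m s]_x f x = \int[mu]_x (f x * (normal_pdf m s x)%:E))%E.
Proof.
move=> mf; rewrite integralE [RHS]integralE.
have pdf0 x : (0 <= (normal_pdf m s x)%:E)%E by rewrite lee_fin normal_pdf_ge0.
rewrite !ge0_integral_normal_prob//; last 2 first.
- exact: measurable_funeneg.
- exact: measurable_funepos.
congr (_ - _)%E; apply: eq_integral => x _.
  by rewrite !funeposE maxe_pMl// mul0e.
by rewrite !funenegE maxe_pMl// mul0e mulNe.
Qed.

Lemma sqrt2_le : Num.sqrt 2 <= 3 / 2 :> R.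
Proof.
rewrite -[leRHS]ger0_norm; last by lra.
by rewrite -sqrtr_sqr ler_wsqrtr//; lra.
Qed.

(** With [u = (x - m) / s], the elementary inequality [|u| <= exp (u ^ 2 / 4)]
    absorbs the factor [|u|] into a Gaussian density whose variance is twice as
    large. It bounds first moments without any integration by parts. *)
Lemma normal_pdf_first_moment m s x : 0 < s ->
  `|x - m| * normal_pdf m s x <=
  (Num.sqrt 2 * s) * normal_pdf m (Num.sqrt 2 * s) x.
Proof.
move=> s0; have r0 : 0 < Num.sqrt 2 :> R by rewrite sqrtr_gt0.
have rs0 : 0 < Num.sqrt 2 * s by exact: mulr_gt0.
rewrite !normal_pdfE ?gt_eqF// /normal_peak /normal_fun.
set u := x - m; set p := Num.sqrt (s ^+ 2 * pi *+ 2).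
have p0 : 0 < p by rewrite sqrtr_gt0 mulrn_wgt0// mulr_gt0 ?pi_gt0// exprn_gt0.
have -> : Num.sqrt ((Num.sqrt 2 * s) ^+ 2 * pi *+ 2) = Num.sqrt 2 * p.
  by rewrite exprMn sqr_sqrtr// -mulrA -mulrnAr sqrtrM.
have -> : - u ^+ 2 / ((Num.sqrt 2 * s) ^+ 2 *+ 2) = - (u ^+ 2 / (4 * s ^+ 2)).
  by rewrite exprMn sqr_sqrtr//; field; exact: lt0r_neq0.
have -> : - u ^+ 2 / (s ^+ 2 *+ 2) = - (u ^+ 2 / (4 * s ^+ 2)) - u ^+ 2 / (4 * s
    ^+ 2).
  by field; exact: lt0r_neq0.
set w := u ^+ 2 / (4 * s ^+ 2).
have -> : (Num.sqrt 2 * s) * ((Num.sqrt 2 * p)^-1 * expR (- w)) =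
   s * (p^-1 * expR (- w)).
  by field; rewrite !lt0r_neq0.
rewrite mulrCA [leRHS]mulrCA ler_pM2l ?invr_gt0//.
rewrite expRD mulrA ler_pM2r ?expR_gt0//.
rewrite expRN ler_pdivrMr ?expR_gt0//.
suff : `|u| / s <= expR w by rewrite ler_pdivrMr// mulrC.
apply: le_trans (expR_ge1Dx w).
have -> : w = (`|u| / s) ^+ 2 / 4.
  by rewrite /w expr_div_n real_normK ?num_real//; field; exact: lt0r_neq0.
(* With [z = |u| / s], this is [z <= 1 + z ^ 2 / 4]. *)
have := sqr_ge0 (`|u| / s / 2 - 1); nra.
Qed.

Lemma normal_prob_abs_moment s : 0 < s ->
  (\int[normal_prob 0 s]_x (`|x|)%:E <= (Num.sqrt 2 * s)%:E)%E.
Proof.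
move=> s0; have rs0 : 0 < Num.sqrt 2 * s by rewrite mulr_gt0// sqrtr_gt0.
have mabs : measurable_fun setT (fun x : R => (`|x|)%:E).
  by apply/measurable_EFinP; exact: normr_measurable.
rewrite ge0_integral_normal_prob//.
rewrite -[leRHS]mule1 -(integral_normal_pdf 0 (Num.sqrt 2 * s)).
rewrite -ge0_integralZl//; last 3 first.
- by apply/measurable_EFinP; exact: measurable_normal_pdf.
- by move=> x _; rewrite lee_fin normal_pdf_ge0.
- exact: ltW.
apply: ge0_le_integral => //.
- by move=> x _; rewrite mule_ge0// lee_fin normal_pdf_ge0.
- by apply: emeasurable_funM => //; apply/measurable_EFinP;
    exact: measurable_normal_pdf.
- by apply: emeasurable_funM => //; apply/measurable_EFinP;
    exact: measurable_normal_pdf.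
- by move=> x _; rewrite lee_fin; have := normal_pdf_first_moment 0 x s0;
    rewrite subr0.
Qed.

(** At the larger of the two densities, [1 - exp (- z) <= z] bounds the
    difference by the density times the difference of the two exponents. *)
Lemma normal_pdf_dist_le m m' s x : 0 < s ->
  `|normal_pdf m s x - normal_pdf m' s x| <=
  `|m - m'| / (s ^+ 2 *+ 2) *
  ((2 * `|x - m| + `|m - m'|) * normal_pdf m s x +
   (2 * `|x - m'| + `|m - m'|) * normal_pdf m' s x).
Proof.
move=> s0; wlog : m m' / (x - m) ^+ 2 <= (x - m') ^+ 2 => [H|].
  have [/H//|/ltW/H] := leP ((x - m) ^+ 2) ((x - m') ^+ 2).
  by rewrite distrC [`|m' - m|]distrC [X in _ <= _ * X]addrC.
move=> mm'.
have q0 : 0 < s ^+ 2 *+ 2 by rewrite mulrn_wgt0// exprn_gt0.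
have e1 : (x - m') ^+ 2 - (x - m) ^+ 2 <= `|m - m'| * (2 * `|x - m| + `|m -
    m'|).
  have -> : (x - m') ^+ 2 - (x - m) ^+ 2 = (m - m') * (2 * (x - m) + (m - m'))
      by ring.
  apply: le_trans (ler_norm _) _; rewrite normrM ler_wpM2l//.
  by apply: le_trans (ler_normD _ _) _; rewrite normrM ger0_norm.
set a := _ * normal_pdf m s x; set b := _ * normal_pdf m' s x.
have b0 : 0 <= b by rewrite mulr_ge0 ?normal_pdf_ge0// addr_ge0// mulr_ge0.
apply: (@le_trans _ _ (`|m - m'| / (s ^+ 2 *+ 2) * a)); last first.
  by rewrite ler_wpM2l ?lerDl// divr_ge0// ltW.
rewrite {}/a {b b0}.
have pk := normal_peak_gt0 (lt0r_neq0 s0).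
rewrite !normal_pdfE ?gt_eqF// /normal_fun -mulrBr normrM gtr0_norm//.
rewrite (mulrCA _ (normal_peak s)) [leRHS]mulrCA ler_pM2l//.
set u := - (x - m) ^+ 2 / _; set w := - (x - m') ^+ 2 / _.
have uw : w <= u by rewrite ler_pM2r ?invr_gt0// lerN2.
rewrite ger0_norm; last by rewrite subr_ge0 ler_expR.
have -> : expR u - expR w = (1 - expR (w - u)) * expR u.
  by rewrite mulrBl mul1r -expRD subrK.
rewrite mulrA ler_pM2r ?expR_gt0//.
have := expR_ge1Dx (w - u);
    have : u - w <= `|m - m'| / (s ^+ 2 *+ 2) * (2 * `|x - m| + `|m - m'|).
  by rewrite /u /w -mulrBl mulrAC ler_pM2r ?invr_gt0//; move: e1; lra.
lra.
Qed.

(** Translation invariance of Lebesgue measure, through the increasing change of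
    variable [x + y]. *)
Lemma integral_shift (G : R -> R) y : continuous G -> (forall x, 0 <= G x) ->
  (\int[mu]_x (G x)%:E = \int[mu]_x (G (x + y))%:E)%E.
Proof.
move=> cG G0; pose F (x : R) := x + y.
have dF (x : R) : is_derive x (1 : R) F 1.
  by rewrite /F; apply: is_derive_eq; rewrite addr0.
have F'E : F^`()%classic = cst 1.
  by apply/funext => x; rewrite derive1E derive_val.
rewrite (@increasing_ge0_integration_by_substitutionT _ F G)//.
- by apply: eq_integral => x _; rewrite F'E /F fctE /= mulr1.
- by move=> a b ab; rewrite /F ltrD2r.
- by rewrite F'E; exact: cst_continuous.
- by rewrite F'E; exact: is_cvg_cst.
- by rewrite F'E; exact: is_cvg_cst.
- exact: cvg_addrr_Ny.
- exact: cvg_addrr.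
Qed.

Lemma integrable_bounded_normal_pdf (h : R -> R) m s :
  measurable_fun setT h -> (forall x, `|h x| <= 1) ->
  mu.-integrable setT (EFin \o (fun x => h x * normal_pdf m s x)).
Proof.
move=> mh h1; apply: le_integrable (integrable_normal_pdf m s) => //.
  by apply/measurable_EFinP/measurable_funM => //; exact: measurable_normal_pdf.
move=> x _ /=; rewrite lee_fin normrM (ger0_norm (normal_pdf_ge0 _ _ _)).
by rewrite ler_piMl ?normal_pdf_ge0.
Qed.

Lemma measurable_cos_affine c y : measurable_fun [set: R] (fun x => cos (c + y *
    x)).
Proof.
apply: continuous_measurable_fun => t; apply: continuous_comp;
    last exact: continuous_cos.
by apply: cvgD; [exact: cvg_cst|apply: cvgM; [exact: cvg_cst|exact: cvg_id]].
Qed.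

Lemma Rintegral_normal_pdf m s : \int[mu]_x normal_pdf m s x = 1.
Proof. by rewrite /Rintegral integral_normal_pdf. Qed.

Lemma normal_pdf_shift m s y x : s != 0 ->
  normal_pdf m s (x + y) = normal_pdf (m - y) s x.
Proof. by move=> s0; rewrite !normal_pdfE// /normal_fun opprB addrA. Qed.

(** Translating by [pi / y] changes the sign of the cosine and moves the mean of
    the density. *)
Lemma Rintegral_cos_normal_pdf_shift c y s : 0 < s -> y != 0 ->
  \int[mu]_x (cos (c + y * x) * normal_pdf 0 s x) =
  - \int[mu]_x (cos (c + y * x) * normal_pdf (- (pi / y)) s x).
Proof.
move=> s0 y0; pose G x := (1 + cos (c + y * x)) * normal_pdf 0 s x.
have cG : continuous G.
  move=> t; apply: cvgM; last by apply: continuous_normal_pdf; rewrite gt_eqF.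
  apply: cvgD; first exact: cvg_cst.
  apply: continuous_comp; last exact: continuous_cos.
  by apply: cvgD; [exact: cvg_cst|apply: cvgM; [exact: cvg_cst|exact: cvg_id]].
have G0 x : 0 <= G x.
  by rewrite mulr_ge0 ?normal_pdf_ge0//; have := cos_geN1 (c + y * x); lra.
have := integral_shift (pi / y) cG G0 => /(congr1 fine).
have GE x : G (x + pi / y) =
    normal_pdf (- (pi / y)) s x - cos (c + y * x) * normal_pdf (- (pi / y)) s x.
  rewrite /G; have -> : c + y * (x + pi / y) = (c + y * x) + pi by field.
  by rewrite cosDpi normal_pdf_shift ?gt_eqF// sub0r; ring.
under [X in _ = fine X]eq_integral do rewrite GE.
have ic m := integrable_bounded_normal_pdf m s (measurable_cos_affine c y)
  (fun x => cos_max (c + y * x)).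
have ip m := integrable_normal_pdf m s.
have -> : fine (\int[mu]_x (G x)%:E) =
    \int[mu]_x (normal_pdf 0 s x + cos (c + y * x) * normal_pdf 0 s x).
  by congr fine; apply: eq_integral => x _; rewrite /G mulrDl mul1r.
rewrite RintegralD//; last exact: ip.
rewrite [X in X + _ = _](Rintegral_normal_pdf 0 s).
rewrite -[fine _]/(\int[mu]_x (normal_pdf (- (pi / y)) s x - cos (c + y * x) *
    normal_pdf (- (pi / y)) s x)).
rewrite RintegralB//; last exact: ip.
by rewrite [X in _ = X - _ -> _](Rintegral_normal_pdf _ s); lra.
Qed.

Lemma Rintegral_normal_prob m s (h : R -> R) : measurable_fun setT h ->
  \int[normal_prob m s]_x h x = \int[mu]_x (h x * normal_pdf m s x).
Proof.
move=> mh; rewrite /Rintegral integral_normal_prob//.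
exact/measurable_EFinP.
Qed.

(** By the shift identity, twice the integral is the integral of the cosine
    against the difference of two densities with means [pi / |y|] apart, and
    that difference has an [L1] norm of order [pi / (|y| s)]. This decay, much
    weaker than the exact Gaussian one, is all that is needed. *)
Lemma normal_prob_cos_le c y s : 0 < s -> y != 0 ->
  `|\int[normal_prob 0 s]_x cos (c + y * x)| <= 2 * pi / (`|y| * s).
Proof.
move=> s0 y0; have mc := measurable_cos_affine c y.
have ic m := integrable_bounded_normal_pdf m s mc (fun x => cos_max (c + y *
    x)).
have pi0 := @pi_gt0 R; have y0' : 0 < `|y| by rewrite normr_gt0.
rewrite Rintegral_normal_prob//; set A := \int[mu]_x _.
set e := pi / y.
have eE : `|e| = pi / `|y| by rewrite normrM normfV gtr0_norm.
have e0 : 0 < `|e| by rewrite eE divr_gt0.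
have -> : 2 * pi / (`|y| * s) = 2 * (`|e| / s).
  by rewrite eE; field; rewrite !lt0r_neq0.
have A1 : `|A| <= 1.
  rewrite -(Rintegral_normal_pdf 0 s).
  apply: le_trans (le_normr_Rintegral _ _) _ => //.
  apply: le_Rintegral => //.
  - by apply: integrable_norm; exact: ic.
  - exact: integrable_normal_pdf.
  - move=> x _; rewrite normrM (ger0_norm (normal_pdf_ge0 _ _ _)).
    by rewrite ler_piMl ?normal_pdf_ge0 ?cos_max.
(* When the shift [|e|] exceeds [s], the claim follows from the trivial
   bound. *)
have [se|es] := leP s `|e|.
  apply: (le_trans A1); have : 1 <= `|e| / s by rewrite ler_pdivlMr// mul1r.
  lra.
pose r := Num.sqrt 2 * s.
have r0 : 0 < r by rewrite mulr_gt0// sqrtr_gt0.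
pose k := `|e| / (s ^+ 2 *+ 2).
have k0 : 0 <= k by rewrite divr_ge0// mulrn_wge0// sqr_ge0.
(* [b] dominates the difference of the densities, by [normal_pdf_dist_le] and
   [normal_pdf_first_moment]. *)
pose b x := k * ((2 * r * normal_pdf 0 r x + `|e| * normal_pdf 0 s x) +
  (2 * r * normal_pdf (- e) r x + `|e| * normal_pdf (- e) s x)).
have ip m t a : mu.-integrable setT (EFin \o (fun x => a * normal_pdf m t x)).
  exact: (@integrableZl _ _ _ mu _ measurableT a _ (integrable_normal_pdf m t)).
have ipE m t a : \int[mu]_x (a * normal_pdf m t x) = a.
  rewrite (@RintegralZl _ _ _ mu _ (normal_pdf m t))//.
    by rewrite Rintegral_normal_pdf mulr1.
  exact: integrable_normal_pdf.
have ip2 m : mu.-integrable setT (EFin \o (fun x =>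
    (2 * r * normal_pdf m r x + `|e| * normal_pdf m s x))).
  exact: (integrableD _ (ip m r _) (ip m s _)).
have ib0 : mu.-integrable setT (EFin \o (fun x => ((2 * r * normal_pdf 0 r x +
    `|e| * normal_pdf 0 s x) +
  (2 * r * normal_pdf (- e) r x + `|e| * normal_pdf (- e) s x)))).
  exact: (integrableD _ (ip2 _) (ip2 _)).
have ib : mu.-integrable setT (EFin \o b).
  exact: (@integrableZl _ _ _ mu _ measurableT k _ ib0).
have ibE : \int[mu]_x b x = k * (4 * r + 2 * `|e|).
  by rewrite /b RintegralZl// !RintegralD// !ipE; ring.
have A2 : `|A + A| <= k * (4 * r + 2 * `|e|).
  rewrite {2}/A Rintegral_cos_normal_pdf_shift// -/e -RintegralB// -ibE.
  apply: le_trans (le_normr_Rintegral _ _) _ => //.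
    exact: (integrableB _ (ic _) (ic _)).
  apply: le_Rintegral => //.
    by apply: integrable_norm; exact: (integrableB _ (ic _) (ic _)).
  move=> x _; rewrite -mulrBr normrM.
  apply: (@le_trans _ _ `|normal_pdf 0 s x - normal_pdf (- e) s x|).
    by rewrite ler_piMl ?cos_max.
  apply: le_trans (normal_pdf_dist_le _ _ _ s0) _.
  rewrite sub0r opprK -/k /b ler_wpM2l// !mulrDl.
  have := normal_pdf_first_moment 0 x s0.
  have := normal_pdf_first_moment (- e) x s0.
  by rewrite !subr0 opprK /r; lra.
have AA : `|A + A| = 2 * `|A|.
  have -> : A + A = 2 * A by ring.
  by rewrite normrM ger0_norm.
rewrite {}AA in A2.
have kE : k * (4 * r + 2 * `|e|) = 2 * (`|e| / s) * (Num.sqrt 2 + `|e| / s / 2).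
  by rewrite /k /r; field; exact: lt0r_neq0.
rewrite {}kE in A2.
have q1 : `|e| / s <= 1 by rewrite ler_pdivrMr// mul1r ltW.
have q0 : 0 <= `|e| / s by rewrite divr_ge0 // ltW.
have := sqrt2_le; nra.
Qed.

End gaussian.

(** * Independence and expectation *)

Section expectation.
Context d (Omega : measurableType d) (R : realType) (P : probability Omega R).
Implicit Types (U W : Omega -> R) (M : R).

Lemma bounded_integrable U M : measurable_fun setT U -> (forall w, `|U w| <= M)
    ->
  P.-integrable setT (EFin \o U).
Proof.
move=> mU UM; apply: measurable_bounded_integrable => //.
  by apply: (@le_lt_trans _ _ 1%E); [exact: probability_le1|rewrite ltry].
by exists M; split; rewrite ?num_real// => x Mx w _;
    exact: le_trans (UM w) (ltW _).
Qed.

Lemma Rintegral_cst_prob (c : R) : \int[P]_(w in setT) c = c.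
Proof.
rewrite Rintegral_cst//; transitivity (c * 1); last exact: mulr1.
congr (_ * _); exact: (congr1 fine (@probability_setT _ _ _ P)).
Qed.

(** Independence on the level of events, for two real functions that need not be
    packaged as random variables. *)
Definition independent_rv U W := forall A B : set R, measurable A -> measurable
    B ->
  P (U @^-1` A `&` W @^-1` B) = (P (U @^-1` A) * P (W @^-1` B))%E.

(** The law of the pair is the product of the laws, so Tonelli applies. Absolute
    values make the integrand nonnegative on the whole plane. *)
Lemma ge0_independent_expectation U W :
  measurable_fun setT U -> measurable_fun setT W ->
  (forall w, 0 <= U w) -> (forall w, 0 <= W w) -> independent_rv U W ->
  (\int[P]_w (U w * W w)%:E = \int[P]_w (U w)%:E * \int[P]_w (W w)%:E)%E.
Proof.
move=> mU mW U0 W0 UW.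
pose U' : {RV P >-> R} := HB.pack U (isMeasurableFun.Build _ _ _ _ _ mU).
pose W' : {RV P >-> R} := HB.pack W (isMeasurableFun.Build _ _ _ _ _ mW).
have mUW := measurable_fun_pair mU mW.
pose UW' : {RV P >-> (R * R)%type} := HB.pack (fun w => (U w, W w))
    (isMeasurableFun.Build _ _ _ _ _ mUW).
pose f (z : R * R) : \bar R := (`|z.1| * `|z.2|)%:E.
have mabs : measurable_fun setT (fun x : R => (`|x|)%:E).
  by apply/measurable_EFinP; exact: normr_measurable.
have mf : measurable_fun setT f.
  apply/measurable_EFinP/measurable_funM.
    by apply: measurableT_comp => //; exact: measurable_fst.
  by apply: measurableT_comp => //; exact: measurable_snd.
have f0 z : (0 <= f z)%E by rewrite lee_fin mulr_ge0.
transitivity (\int[distribution P UW']_z f z)%E.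
  rewrite ge0_integral_distribution//; apply: eq_integral => w _ /=.
  by rewrite /f /= !ger0_norm.
have prodE : forall X, measurable X ->
    (distribution P U' \x distribution P W')%E X = distribution P UW' X.
  apply: product_measure_unique => A B mA mB; exact: UW.
transitivity (\int[(distribution P U' \x distribution P W')%E]_z f z)%E.
  by apply/esym/eq_measure_integral => X mX _; exact: prodE.
rewrite fubini_tonelli1// /fubini_F.
transitivity (\int[distribution P U']_x (`|x|%:E * \int[distribution P W']_y
    `|y|%:E))%E.
  apply: eq_integral => x _; rewrite /f/=.
  under eq_integral do rewrite EFinM.
  by rewrite ge0_integralZl.
rewrite ge0_integralZr//; last exact: integral_ge0.
rewrite !ge0_integral_distribution//.
congr (_ * _)%E; apply: eq_integral => w _ /=; by rewrite ger0_norm.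
Qed.

(** Adding the constants [M] and [N] reduces to nonnegative functions. *)
Lemma independent_expectation U W M N :
  measurable_fun setT U -> measurable_fun setT W ->
  (forall w, `|U w| <= M) -> (forall w, `|W w| <= N) -> independent_rv U W ->
  \int[P]_w (U w * W w) = \int[P]_w U w * \int[P]_w W w.
Proof.
move=> mU mW UM WN UW.
have iU := bounded_integrable mU UM; have iW := bounded_integrable mW WN.
have N0 : 0 <= N by exact: le_trans (normr_ge0 _) (WN point).
have iUW : P.-integrable setT (EFin \o (fun w => U w * W w)).
  apply: (@bounded_integrable _ (M * N)); first exact: measurable_funM.
  by move=> w; rewrite normrM ler_pM.
have icst c : P.-integrable setT (EFin \o (fun _ : Omega => c : R)).
  by apply: (@bounded_integrable _ `|c|) => //; exact: measurable_cst.
pose U' w := U w + M; pose W' w := W w + N.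
have U'W' : independent_rv U' W'.
  move=> A B mA mB.
  have -> : U' @^-1` A = U @^-1` ((fun x => x + M) @^-1` A) by [].
  have -> : W' @^-1` B = W @^-1` ((fun x => x + N) @^-1` B) by [].
  have mT c (C : set R) : measurable C -> measurable ((fun x : R => x + c) @^-1`
      C).
    move=> mC; rewrite -[X in measurable X]setTI.
    have mc : measurable_fun [set: R] (fun x : R => x + c) by exact:
        measurable_funD.
    exact: mc.
  by apply: UW; exact: mT.
have := @ge0_independent_expectation U' W'.
have mU' : measurable_fun setT U' by exact: measurable_funD.
have mW' : measurable_fun setT W' by exact: measurable_funD.
have U'0 w : 0 <= U' w by have := UM w; rewrite ler_norml /U'; lra.
have W'0 w : 0 <= W' w by have := WN w; rewrite ler_norml /W'; lra.
move=> /(_ mU' mW' U'0 W'0 U'W') /(congr1 fine).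
have iU' : P.-integrable setT (EFin \o U') by exact: integrableD _ iU (icst M).
have iW' : P.-integrable setT (EFin \o W') by exact: integrableD _ iW (icst N).
rewrite fineM; [|exact: integrable_fin_num..].
rewrite -[fine _]/(\int[P]_w (U' w * W' w)) -[X in _ = X * _]/(\int[P]_w U' w)
  -[X in _ = _ * X]/(\int[P]_w W' w).
have cstE c : \int[P]_w (fun _ : Omega => c : R) w = c.
  exact: Rintegral_cst_prob.
have -> : \int[P]_w U' w = \int[P]_w U w + M by rewrite RintegralD// cstE.
have -> : \int[P]_w W' w = \int[P]_w W w + N by rewrite RintegralD// cstE.
have -> : \int[P]_w (U' w * W' w) = \int[P]_w (U w * W w + (N * U w + (M * W w +
    M * N))).
  by apply: eq_Rintegral => w _; rewrite /U' /W'; ring.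
have iNU : P.-integrable setT (EFin \o (fun w => N * U w)).
  exact: (@integrableZl _ _ _ P _ measurableT N _ iU).
have iMW : P.-integrable setT (EFin \o (fun w => M * W w)).
  exact: (@integrableZl _ _ _ P _ measurableT M _ iW).
have i1 : P.-integrable setT (EFin \o (fun w => M * W w + M * N)).
  exact: (integrableD _ iMW (icst _)).
have i2 : P.-integrable setT (EFin \o (fun w => N * U w + (M * W w + M * N))).
  exact: (integrableD _ iNU i1).
by rewrite RintegralD// RintegralD// RintegralD// !RintegralZl// cstE; lra.
Qed.

(** Independence passes from a pi-system to the sigma-algebra that it generates:
    both sides of the product rule are finite measures of the first event. *)
Lemma independent_rv_sigma (H : set (set Omega)) U W :
  H `<=` measurable -> setI_closed H -> H setT -> measurable_fun setT W ->
  (forall E (B : set R), H E -> measurable B ->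
    P (E `&` W @^-1` B) = (P E * P (W @^-1` B))%E) ->
  @measurable_fun _ _ (g_sigma_algebraType H) R setT U -> independent_rv U W.
Proof.
move=> Hm HI HT mW HW mU A B mA mB.
have mWB : measurable (W @^-1` B).
  by rewrite -[X in measurable X]setTI; exact: mW.
have HA : <<s H >> (U @^-1` A).
  by have := mU measurableT A mA; rewrite setTI.
have p0 : 0 <= fine (P (W @^-1` B)) by rewrite fine_ge0.
have := @g_sigma_algebra_measure_unique _ _ _ H Hm (fun=> setT) (fun=> HT) _
  (mrestr P mWB) (mscale (NngNum p0) P) HI.
move=> /(_ _ _ _ _ HA); rewrite /= /mrestr /mscale/= => ->//.
- by rewrite muleC fineK ?fin_num_measure.
- by apply/seteqP; split => // w _; exists 0.
- by move=> E HE; rewrite HW// muleC fineK ?fin_num_measure.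
- move=> _; apply: (@le_lt_trans _ _ 1%E); last by rewrite ltry.
  by rewrite setTI; exact: probability_le1.
Qed.

Lemma measurable_fun_g_sigma_algebra (H : set (set Omega)) U :
  H `<=` measurable ->
  @measurable_fun _ _ (g_sigma_algebraType H) R setT U -> measurable_fun setT U.
Proof.
move=> Hm mU _ A mA; have := mU measurableT A mA; rewrite !setTI.
by apply: smallest_sub => //; exact: sigma_algebra_measurable.
Qed.

End expectation.

(** * Processes with independent Gaussian increments *)

(** The properties of the rescaled process that the Fourier estimates use. The
    process is indexed by all real times but only constrained on [[0, 1]], and
    [v] is its variance function up to an additive constant. *)
Record gaussian_increments d (Omega : measurableType d) (R : realType)
    (P : probability Omega R) (Y : R -> Omega -> R) (v : R -> R) : Prop := {
  gi_measurable : forall t, measurable_fun setT (Y t) ;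
  gi_start : forall w, Y 0 w = 0 ;
  gi_indep : forall n (t : nat -> R),
    (forall i, (i <= n)%N -> 0 <= t i <= 1) ->
    (forall i, (i < n)%N -> t i <= t i.+1) ->
    mutually_independent P (fun (i : 'I_n) w => Y (t i.+1) w - Y (t i) w) ;
  gi_law : forall s t, 0 <= s -> s < t -> t <= 1 -> v s < v t /\
    forall A : set R, measurable A ->
    P ((fun w => Y t w - Y s w) @^-1` A) = normal_prob 0 (Num.sqrt (v t - v s))
        A }.

Section past.
Context d (Omega : measurableType d) (R : realType) (P : probability Omega R).
Variables (Y : R -> Omega -> R) (v : R -> R).
Hypothesis GY : gaussian_increments P Y v.
Let mY := gi_measurable GY.
Implicit Types (tau : nat -> R) (J : nat) (U : Omega -> R).

(** The rectangles in the first [J] increments along the times [tau]. They form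
    a pi-system, for which independence of a later increment is immediate, and
    generate the information available at time [tau J]. *)
Definition past tau J : set (set Omega) :=
  [set E | exists2 A : nat -> set R, (forall i, measurable (A i)) &
    E = \bigcap_(i in `I_J) ((fun w => Y (tau i.+1) w - Y (tau i) w) @^-1` A
        i)].

(** Measurability for the sigma-algebra generated by [past tau J]; the generated
    type lets the closure lemmas for measurable functions apply. *)
Definition past_measurable tau J U :=
  @measurable_fun _ _ (g_sigma_algebraType (past tau J)) R setT U.

Lemma measurable_increment s t : measurable_fun setT (fun w => Y t w - Y s w).
Proof. exact: measurable_funB. Qed.

Lemma measurable_increment_preimage s t (A : set R) : measurable A ->
  measurable ((fun w => Y t w - Y s w) @^-1` A).
Proof. by move=> mA; rewrite -[X in measurable X]setTI;
    exact: measurable_increment. Qed.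

Lemma sub_past_measurable tau J : past tau J `<=` measurable.
Proof.
move=> E [A mA ->]; case: J => [|J].
  by rewrite II0 bigcap_set0.
apply: bigcap_measurable; first by exists 0%N.
by move=> i _; exact: measurable_increment_preimage.
Qed.

Lemma past_setI tau J : setI_closed (past tau J).
Proof.
move=> _ _ [A mA ->] [B mB ->]; exists (fun i => A i `&` B i).
  by move=> i; exact: measurableI.
by rewrite -bigcapI; apply: eq_bigcapr => i _; rewrite preimage_setI.
Qed.

Lemma past_setT tau J : past tau J setT.
Proof.
by exists (fun=> setT) => //; apply/esym/seteqP; split.
Qed.

Lemma past_increment tau J i : (i < J)%N ->
  past_measurable tau J (fun w => Y (tau i.+1) w - Y (tau i) w).
Proof.
move=> iJ _ A mA; rewrite setTI; apply: sub_sigma_algebra.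
exists (fun k => if k == i then A else setT).
  by move=> k; case: ifP.
apply/seteqP; split => w /=.
  by move=> Aw k kJ /=; case: eqP => [->|].
by move=> /(_ i iJ) /=; rewrite eqxx.
Qed.

Lemma past_value tau J i : tau 0%N = 0 -> (i <= J)%N -> past_measurable tau J (Y
    (tau i)).
Proof.
move=> tau0; elim: i => [_|i IH iJ].
  rewrite tau0 (_ : Y 0 = cst 0); first exact: measurable_cst.
  by apply/funext => w; rewrite (gi_start GY).
rewrite (_ : Y (tau i.+1) = fun w => Y (tau i) w + (Y (tau i.+1) w - Y (tau i)
    w)).
  exact: (measurable_funD (IH (ltnW iJ)) (past_increment iJ)).
by apply/funext => w; rewrite addrC subrK.
Qed.

Lemma past_measurableW tau J U : past_measurable tau J U -> measurable_fun setT
    U.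
Proof. by apply: measurable_fun_g_sigma_algebra;
    exact: sub_past_measurable. Qed.

Lemma increments_bigcap n (t : nat -> R) (A : nat -> set R) :
  (forall i, (i <= n)%N -> 0 <= t i <= 1) ->
  (forall i, (i < n)%N -> t i <= t i.+1) -> (forall i, measurable (A i)) ->
  P (\bigcap_(i in `I_n) ((fun w => Y (t i.+1) w - Y (t i) w) @^-1` A i)) =
  (\prod_(i < n) P ((fun w => (Y (t i.+1) w - Y (t i) w)%R) @^-1` A i))%E.
Proof.
move=> t01 tm mA; rewrite -(gi_indep GY t01 tm (A := fun i => A i))//.
congr (P _); apply/seteqP; split => w /= H i /=.
  by move=> _; exact: (H i (ltn_ord i)).
by move=> iN; exact: (H (Ordinal iN) I).
Qed.

(** The times [tau 0, ..., tau J, t] form one nondecreasing sequence, whose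
    increments are mutually independent. *)
Lemma past_independent tau J t E (B : set R) :
  (forall i, (i <= J)%N -> 0 <= tau i <= 1) ->
  (forall i, (i < J)%N -> tau i <= tau i.+1) ->
  tau J <= t <= 1 -> past tau J E -> measurable B ->
  P (E `&` (fun w => Y t w - Y (tau J) w) @^-1` B) =
  (P E * P ((fun w => (Y t w - Y (tau J) w)%R) @^-1` B))%E.
Proof.
move=> t01 tm /andP[Jt t1] [A mA ->] mB.
pose t' i := if (i <= J)%N then tau i else t.
pose A' i := if (i < J)%N then A i else B.
have t'01 i : (i <= J.+1)%N -> 0 <= t' i <= 1.
  rewrite /t' => _; case: ifP => [/t01//|_]; rewrite t1 andbT.
  by have /andP[+ _] := t01 J (leqnn _); move/le_trans; apply.
have t'm i : (i < J.+1)%N -> t' i <= t' i.+1.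
  rewrite ltnS /t' => iJ; rewrite iJ; case: (ltnP i J) => [/tm//|Ji].
  by have -> : i = J by apply/eqP; rewrite eqn_leq iJ.
have mA' i : measurable (A' i) by rewrite /A'; case: ifP.
have := increments_bigcap t'01 t'm mA'.
rewrite big_ord_recr/=.
have -> : (\prod_(i < J) P ((fun w => (Y (t' i.+1) w - Y (t' i) w)%R) @^-1` A'
    i))%E =
  (\prod_(i < J) P ((fun w => (Y (tau i.+1) w - Y (tau i) w)%R) @^-1` A i))%E.
  by apply: eq_bigr => -[i iJ] _ /=; rewrite /t' /A' iJ ltnW.
rewrite -increments_bigcap//.
have -> : (fun w => Y (t' J.+1) w - Y (t' J) w) @^-1` A' J =
    (fun w => Y t w - Y (tau J) w) @^-1` B.
  by rewrite /t' /A' ltnn leqnn.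
move=> <-; congr (P _); apply/seteqP; split => w /=.
  move=> [H HB] i /=; rewrite ltnS leq_eqVlt => /predU1P[->|iJ].
    by rewrite /t' /A' ltnn leqnn.
  by rewrite /t' /A' iJ (ltnW iJ); exact: (H i).
move=> H; split.
  move=> i /= iJ; have := H i (leqW iJ).
  by rewrite /= /t' /A' iJ (ltnW iJ).
by have := H J (ltnSn J); rewrite /= /t' /A' ltnn leqnn.
Qed.

Lemma past_expectation tau J t U (h : R -> R) M N :
  (forall i, (i <= J)%N -> 0 <= tau i <= 1) ->
  (forall i, (i < J)%N -> tau i <= tau i.+1) ->
  tau J <= t <= 1 -> past_measurable tau J U -> (forall w, `|U w| <= M) ->
  measurable_fun setT h -> (forall x, `|h x| <= N) ->
  \int[P]_w (U w * h (Y t w - Y (tau J) w)) =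
  \int[P]_w U w * \int[P]_w h (Y t w - Y (tau J) w).
Proof.
move=> t01 tm tJ pU UM mh hN.
apply: (@independent_expectation _ _ _ _ _ _ M N) => //.
- exact: past_measurableW pU.
- by apply: measurableT_comp => //; exact: measurable_increment.
have UD : independent_rv P U (fun w => Y t w - Y (tau J) w).
  apply: (@independent_rv_sigma _ _ _ _ (past tau J)) => //.
  - exact: sub_past_measurable.
  - exact: past_setI.
  - exact: past_setT.
  - exact: measurable_increment.
  - by move=> E B; exact: past_independent.
move=> A B mA mB.
have mhB : measurable (h @^-1` B).
  by rewrite -[X in measurable X]setTI; exact: mh.
exact: (UD A _ mA mhB).
Qed.

Lemma expectation_cos_increment_le c y s t : 0 <= s -> s < t -> t <= 1 -> y != 0
    ->
  `|\int[P]_w cos (c + y * (Y t w - Y s w))| <=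
  2 * pi / (`|y| * Num.sqrt (v t - v s)).
Proof.
move=> s0 st t1 y0; have [vst law] := gi_law GY s0 st t1.
have mD : @measurable_fun _ _ Omega (measurableTypeR R) setT (fun w => Y t w - Y
    s w).
  exact: measurable_increment.
pose D : {RV P >-> measurableTypeR R} := HB.pack (fun w => Y t w - Y s w)
  (isMeasurableFun.Build _ _ _ _ _ mD).
have mc := @measurable_cos_affine R c y.
have -> : \int[P]_w cos (c + y * (Y t w - Y s w)) =
    \int[normal_prob 0 (Num.sqrt (v t - v s))]_x cos (c + y * x).
  congr fine.
  transitivity (\int[distribution P D]_x (cos (c + y * x))%:E)%E; last first.
    by apply: eq_measure_integral => A mA _; exact: law.
  rewrite integral_distribution//.
    exact/measurable_EFinP.
  apply: (@bounded_integrable _ _ _ _ _ 1).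
    apply: (measurableT_comp mc); exact: measurable_increment.
  by move=> w; exact: cos_max.
by apply: normal_prob_cos_le => //; rewrite sqrtr_gt0 subr_gt0.
Qed.

(** Conditionally on the past, the cosine at a later time has a mean of the size
    of the characteristic function of the increment. The addition formula splits
    [Y t] into its value at [tau J] and an independent increment. *)
Lemma past_cos_expectation_le tau J t U M c y :
  tau 0%N = 0 ->
  (forall i, (i <= J)%N -> 0 <= tau i <= 1) ->
  (forall i, (i < J)%N -> tau i <= tau i.+1) ->
  tau J < t <= 1 -> past_measurable tau J U -> (forall w, 0 <= U w <= M) ->
  y != 0 ->
  `|\int[P]_w (U w * cos (c + y * Y t w))| <=
  2 * (2 * pi / (`|y| * Num.sqrt (v t - v (tau J)))) * \int[P]_w U w.
Proof.
move=> tau0 t01 tm /andP[Jt t1] pU UM y0.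
have tJ : tau J <= t <= 1 by rewrite t1 ltW.
have J0 : 0 <= tau J by have /andP[] := t01 J (leqnn _).
have mU := past_measurableW pU.
have UM' w : `|U w| <= M by have /andP[U0 ?] := UM w; rewrite ger0_norm.
have iU := bounded_integrable P mU UM'.
set e := 2 * pi / _.
pose ca w := U w * cos (c + y * Y (tau J) w).
pose sa w := U w * - sin (c + y * Y (tau J) w).
have mcY : past_measurable tau J (fun w => cos (c + y * Y (tau J) w)).
  exact: (measurableT_comp (measurable_cos_affine c y) (past_value tau0 (leqnn
      J))).
have msY : past_measurable tau J (fun w => - sin (c + y * Y (tau J) w)).
  rewrite (_ : (fun w => _) = fun w => cos ((c + pi / 2) + y * Y (tau J) w)).
    exact: (measurableT_comp (measurable_cos_affine _ y) (past_value tau0 (leqnn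
        J))).
  by apply/funext => w; rewrite -cosDpihalf; congr cos; ring.
have pca : past_measurable tau J ca by exact: measurable_funM.
have psa : past_measurable tau J sa by exact: measurable_funM.
have caU w : `|ca w| <= U w.
  have /andP[U0 _] := UM w.
  by rewrite normrM (ger0_norm U0) ler_piMr// cos_max.
have saU w : `|sa w| <= U w.
  have /andP[U0 _] := UM w.
  by rewrite normrM normrN (ger0_norm U0) ler_piMr// sin_max.
have caM w : `|ca w| <= M by have /andP[_ ?] := UM w; exact: le_trans (caU w) _.
have saM w : `|sa w| <= M by have /andP[_ ?] := UM w; exact: le_trans (saU w) _.
have mcos : measurable_fun setT (fun x : R => cos (0 + y * x)) by exact:
    measurable_cos_affine.
have mcos' : measurable_fun setT (fun x : R => cos (- (pi / 2) + y * x)) by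
    exact: measurable_cos_affine.
have EL (Z : Omega -> R) : past_measurable tau J Z -> (forall w, `|Z w| <= U w)
    ->
    `|\int[P]_w Z w| <= \int[P]_w U w.
  move=> pZ ZU.
  have iZ : P.-integrable setT (EFin \o Z).
    apply: (@bounded_integrable _ _ _ _ _ M); first exact: past_measurableW pZ.
    by move=> w; have /andP[_ ?] := UM w; exact: le_trans (ZU w) _.
  apply: le_trans (le_normr_Rintegral _ _) _ => //.
  apply: le_Rintegral => //; exact: integrable_norm.
have -> : \int[P]_w (U w * cos (c + y * Y t w)) =
   \int[P]_w (ca w * cos (0 + y * (Y t w - Y (tau J) w)) +
              sa w * cos (- (pi / 2) + y * (Y t w - Y (tau J) w))).
  apply: eq_Rintegral => w _; rewrite /ca /sa add0r.
  rewrite (addrC (- (pi / 2))) cosBpihalf.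
  have -> : c + y * Y t w = (c + y * Y (tau J) w) + y * (Y t w - Y (tau J) w) by
      ring.
  by rewrite cosD; ring.
have mD a : measurable_fun setT (fun w => cos (a + y * (Y t w - Y (tau J) w))).
  apply: (measurableT_comp (@measurable_cos_affine R a y)).
  exact: measurable_increment.
have ib (Z : Omega -> R) a : past_measurable tau J Z -> (forall w, `|Z w| <= M)
    ->
    P.-integrable setT (EFin \o (fun w => Z w * cos (a + y * (Y t w - Y (tau J)
        w)))).
  move=> pZ ZM; apply: (@bounded_integrable _ _ _ _ _ M).
    by apply: measurable_funM => //; exact: past_measurableW pZ.
  by move=> w; rewrite normrM; apply: le_trans (ZM w);
      rewrite ler_piMr// cos_max.
rewrite RintegralD//; [|exact: ib|exact: ib].
rewrite (past_expectation t01 tm tJ pca caM mcos (fun x => cos_max _)).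
rewrite (past_expectation t01 tm tJ psa saM mcos' (fun x => cos_max _)).
have e1 := expectation_cos_increment_le 0 J0 Jt t1 y0.
have e2 := expectation_cos_increment_le (- (pi / 2)) J0 Jt t1 y0.
apply: le_trans (ler_normD _ _) _; rewrite !normrM.
have -> : 2 * e * \int[P]_w U w = \int[P]_w U w * e + \int[P]_w U w * e by ring.
apply: lerD; apply: ler_pM => //; exact: EL.
Qed.

End past.

(** * Exponential moments of sums of block averages *)

(** From [exp (x / 2) <= 1 / (1 - x / 2)], squared. *)
Lemma expR_le_quadratic (R : realType) (x : R) : `|x| <= 1 -> expR x <= 1 + x +
    2 * x ^+ 2.
Proof.
rewrite ler_norml => /andP[x1 x2].
have h : 0 < 1 - x / 2 by lra.
have e1 : expR (x / 2) <= (1 - x / 2)^-1.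
  rewrite -[leLHS]invrK -expRN lef_pV2 ?posrE ?expR_gt0//.
  by have := expR_ge1Dx (- (x / 2)); lra.
have -> : x = x / 2 + x / 2 by lra.
rewrite expRD -splitr.
apply: (@le_trans _ _ ((1 - x / 2)^-1 * (1 - x / 2)^-1)).
  by rewrite ler_pM ?expR_ge0.
rewrite -invfM -[leLHS]mul1r ler_pdivrMr ?mulr_gt0//.
have : 0 <= x ^+ 2 * ((1 - x) * (5 / 4 - x / 2)).
  by rewrite mulr_ge0 ?sqr_ge0// mulr_ge0; lra.
by rewrite expr2; nra.
Qed.

Section exponential_moment.
Context d (Omega : measurableType d) (R : realType) (P : probability Omega R).
Variables (Y : R -> Omega -> R) (v : R -> R).
Hypothesis GY : gaussian_increments P Y v.
Variables (n N m' : nat) (c x y th eps : R).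
Let m := (N * m')%N.

(** The [n] blocks of [[0, 1]] are each cut into [N] cells of [m'] points: the
    first cell, a fraction [1 / N] of the block, is where no decay is
    available. *)
Definition grid (i : nat) : R := i%:R / (n * m)%:R.

Definition block_avg (j : nat) (w : Omega) : R :=
  m%:R^-1 * \sum_(k < m) cos (c + x * grid (j * m + k) + y * Y (grid (j * m +
      k)) w).

Definition block_sum (j : nat) (w : Omega) : R := \sum_(i < j) block_avg i w.

Hypotheses (n0 : (0 < n)%N) (N0 : (0 < N)%N) (m'0 : (0 < m')%N).
Let m0 : (0 < m)%N. Proof. by rewrite muln_gt0 N0. Qed.
Let nm0 : (0 < n * m)%N. Proof. by rewrite muln_gt0 n0. Qed.
Let nmR : (0 : R) < (n * m)%:R. Proof. by rewrite ltr0n. Qed.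
Let mR : (0 : R) < m%:R. Proof. by rewrite ltr0n. Qed.

Lemma grid0 : grid 0 = 0. Proof. by rewrite /grid mul0r. Qed.

Lemma le_grid i j : (i <= j)%N -> grid i <= grid j.
Proof. by move=> ij; rewrite /grid ler_pM2r ?invr_gt0// ler_nat. Qed.

Lemma grid01 i : (i <= n * m)%N -> 0 <= grid i <= 1.
Proof.
move=> i1; rewrite /grid divr_ge0//= ler_pdivrMr// mul1r.
by rewrite ler_nat.
Qed.

Lemma norm_block_avg_le1 j w : `|block_avg j w| <= 1.
Proof.
rewrite /block_avg normrM gtr0_norm ?invr_gt0// mulrC ler_pdivrMr// mul1r.
apply: le_trans (ler_norm_sum _ _ _) _.
rewrite -[X in _ <= X%:R]card_ord -sumr_const ler_sum// => k _; exact: cos_max.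
Qed.

Lemma norm_block_sum_le j w : `|block_sum j w| <= j%:R.
Proof.
apply: le_trans (ler_norm_sum _ _ _) _.
rewrite -[X in _ <= X%:R]card_ord -sumr_const ler_sum// => k _.
exact: norm_block_avg_le1.
Qed.

(** Blocks before [j] only involve the path up to the left end of block [j]. *)
Lemma past_block_avg j i : (i < j)%N -> past_measurable Y grid (j * m)
    (block_avg i).
Proof.
move=> ij; apply: measurable_funM; first exact: measurable_cst.
apply: measurable_sum => k.
have kj : (i * m + k <= j * m)%N.
  rewrite (@leq_trans (i.+1 * m))//; last by rewrite leq_mul2r ij orbT.
  by rewrite mulSn addnC leq_add2r ltnW.
exact: (measurableT_comp (measurable_cos_affine (c + x * grid (i * m + k)) y)
  (past_value GY grid0 kj)).
Qed.

Lemma past_block_sum j : past_measurable Y grid (j * m) (block_sum j).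
Proof.
apply: measurable_sum => i; exact: past_block_avg.
Qed.

Hypotheses (th0 : 0 <= th) (th1 : th <= 1) (y0 : y != 0).
Hypothesis eps_bound : forall s t, 0 <= s -> s + (n * N)%:R^-1 <= t -> t <= 1 ->
  2 * pi / (`|y| * Num.sqrt (v t - v s)) <= eps.

Let E j := \int[P]_w expR (th * block_sum j w).

Lemma exp_block_sum_bounded j w : 0 <= expR (th * block_sum j w) <= expR j%:R.
Proof.
rewrite expR_ge0 ler_expR/=; have := norm_block_sum_le j w.
rewrite ler_norml => /andP[_ h]; have [h0|h0] := leP 0 (block_sum j w).
  by apply: le_trans h; rewrite ler_piMl.
by rewrite (@le_trans _ _ 0)// nmulr_lle0.
Qed.

Lemma past_exp_block_sum j :
  past_measurable Y grid (j * m) (fun w => expR (th * block_sum j w)).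
Proof.
have mth : measurable_fun [set: R] (fun z : R => expR (th * z)).
  apply: continuous_measurable_fun => z; apply: continuous_comp;
      last exact: continuous_expR.
  by apply: cvgM; [exact: cvg_cst|exact: cvg_id].
exact: (measurableT_comp mth (@past_block_sum j)).
Qed.

(** Points of the first cell of block [j] are too close to its left end and are
    bounded trivially, whence [1 / N]. All others are at distance at least
    [1 / (n N)] from it, so that [past_cos_expectation_le] gives [2 eps]. *)
Lemma exp_block_sum_avg_le j : (j < n)%N ->
  \int[P]_w (expR (th * block_sum j w) * block_avg j w) <= (N%:R^-1 + 2 * eps) *
      E j.
Proof.
move=> jn; have UM := exp_block_sum_bounded j.
have pU := @past_exp_block_sum j.
set U := fun w => expR (th * block_sum j w) in UM pU *.
have mU := past_measurableW GY pU.
pose C k w := cos (c + x * grid (j * m + k) + y * Y (grid (j * m + k)) w).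
have mC k : measurable_fun setT (C k).
  exact: (measurableT_comp (measurable_cos_affine (c + x * grid (j * m + k)) y)
    (gi_measurable GY _)).
have UM' w : `|U w| <= expR j%:R by rewrite ger0_norm; have /andP[] := UM w.
have iUC k : P.-integrable setT (EFin \o (fun w => U w * C k w)).
  apply: (@bounded_integrable _ _ _ _ _ (expR j%:R));
      first exact: measurable_funM.
  by move=> w; rewrite normrM; apply: le_trans (UM' w);
      rewrite ler_piMr// cos_max.
have iU := bounded_integrable P mU UM'.
have E0 : 0 <= E j by apply: Rintegral_ge0 => w _; exact: expR_ge0.
have -> : \int[P]_w (U w * block_avg j w) =
    m%:R^-1 * \sum_(k < m) \int[P]_w (U w * C k w).
  rewrite (_ : (fun w => U w * block_avg j w) =
      fun w => m%:R^-1 * \sum_(k < m) (U w * C k w)); last first.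
    by apply/funext => w; rewrite /block_avg mulrCA mulr_sumr.
  have H (s : seq 'I_m) : P.-integrable setT (EFin \o (fun w => \sum_(k <- s) (U
      w * C k w)))
      /\ \int[P]_w (\sum_(k <- s) (U w * C k w)) = \sum_(k <- s) \int[P]_w (U w
          * C k w).
    elim: s => [|k s [IH1 IH2]].
      rewrite big_nil (_ : (fun w => _) = fun=> 0); last first.
        by apply/funext => w; rewrite big_nil.
      split; last exact: Rintegral_cst_prob.
      by apply: (@bounded_integrable _ _ _ _ _ 0) => // w; rewrite normr0.
    rewrite big_cons -IH2 (_ : (fun w => _) = fun w => U w * C k w + \sum_(k <-
        s) (U w * C k w)); last first.
      by apply/funext => w; rewrite big_cons.
    split; last by rewrite RintegralD.
    exact: (integrableD _ (iUC k) IH1).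
  have [H1 H2] := H (index_enum _).
  by rewrite RintegralZl// H2.
rewrite mulrC ler_pdivrMr//.
have termU k : \int[P]_w (U w * C k w) <= E j.
  apply: le_Rintegral => // w _; have /andP[U0 _] := UM w.
  by rewrite ler_piMr// cos_le1.
have termE k : (m' <= k < m)%N -> \int[P]_w (U w * C k w) <= 2 * eps * E j.
  move=> /andP[mk km].
  apply: le_trans (ler_norm _) _.
  have kn : (j * m + k <= n * m)%N.
    rewrite (@leq_trans (j.+1 * m))//; last by rewrite leq_mul2r jn orbT.
    by rewrite mulSn addnC leq_add2r ltnW.
  have jn' : (j * m <= n * m)%N by rewrite leq_mul2r ltnW ?orbT.
  have k0 : (0 < k)%N by exact: leq_trans mk.
  have lt1 : grid (j * m) < grid (j * m + k).
    by rewrite /grid ltr_pM2r ?invr_gt0// ltr_nat -[X in (X < _)%N]addn0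
        ltn_add2l.
  have /andP[_ le1] := grid01 kn.
  have tt : grid (j * m) < grid (j * m + k) <= 1 by rewrite lt1.
  have t01 i : (i <= j * m)%N -> 0 <= grid i <= 1.
    by move=> ij; apply: grid01; exact: leq_trans jn'.
  have tm i : (i < j * m)%N -> grid i <= grid i.+1 by move=> _; exact: le_grid.
  have := past_cos_expectation_le GY (c + x * grid (j * m + k)) grid0 t01 tm tt
      pU UM y0.
  move/le_trans; apply; rewrite -/(E j) ler_wpM2r// ler_wpM2l//.
  apply: eps_bound => //.
    by have /andP[] := t01 _ (leqnn _).
  rewrite -lerBrDl /grid -mulrBl natrD addrC addKr.
  have -> : (n * N)%:R^-1 = m'%:R / (n * m)%:R :> R.
    by rewrite /m !natrM; field; rewrite !pnatr_eq0 -!lt0n n0 N0 m'0.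
  by rewrite ler_pM2r ?invr_gt0// ler_nat.
have eps0 : 0 <= eps.
  have nN : (n * N)%:R^-1 <= (1 : R).
    by rewrite invf_le1 ?ltr0n ?muln_gt0 ?n0// ler1n muln_gt0 n0.
  apply: le_trans (eps_bound (lexx 0) _ (lexx 1)); last by rewrite add0r.
  by rewrite !mulr_ge0// ?pi_ge0// invr_ge0 mulr_ge0// sqrtr_ge0.
apply: (@le_trans _ _ (\sum_(k < m) ((if (k < m')%N then E j else 0) + 2 * eps *
    E j))).
  apply: ler_sum => k _; case: ifPn => [_|].
    by apply: (le_trans (termU k)); rewrite lerDl !mulr_ge0.
  by rewrite -leqNgt add0r => mk; apply: termE; rewrite mk ltn_ord.
rewrite big_split/= sumr_const card_ord -big_mkcond/=.
have -> : \sum_(k < m | (k < m')%N) E j = E j *+ m'.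
  rewrite -(big_ord_widen m (fun=> E j)); last by rewrite /m leq_pmull.
  by rewrite sumr_const card_ord.
rewrite -[E j *+ m']mulr_natl -[(2 * eps * E j) *+ m]mulr_natl.
have -> : m'%:R = m%:R * N%:R^-1 :> R.
  by rewrite /m natrM; field; rewrite pnatr_eq0 -lt0n.
by rewrite le_eqVlt; apply/orP; left; apply/eqP; ring.
Qed.

(** Expand the exponential of the [j]-th block average to second order; the
    linear term is small by [exp_block_sum_avg_le]. *)
Lemma exp_block_sum_step j : (j < n)%N ->
  E j.+1 <= (1 + 2 * th ^+ 2 + th * (N%:R^-1 + 2 * eps)) * E j.
Proof.
move=> jn; have UM := exp_block_sum_bounded j.
have pU := @past_exp_block_sum j; have mU := past_measurableW GY pU.
have UM' w : `|expR (th * block_sum j w)| <= expR j%:R by rewrite ger0_norm;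
    have /andP[] := UM w.
have iU := bounded_integrable P mU UM'.
have mA : measurable_fun setT (block_avg j).
  exact: (past_measurableW GY (past_block_avg (ltnSn j))).
have iUA : P.-integrable setT (EFin \o (fun w => expR (th * block_sum j w) *
    block_avg j w)).
  apply: (@bounded_integrable _ _ _ _ _ (expR j%:R));
      first exact: measurable_funM.
  by move=> w; rewrite normrM; apply: le_trans (UM' w);
      rewrite ler_piMr// norm_block_avg_le1.
have i1 : P.-integrable setT (EFin \o (fun w => (1 + 2 * th ^+ 2) * expR (th *
    block_sum j w))).
  exact: (@integrableZl _ _ _ P _ measurableT _ _ iU).
have i2 : P.-integrable setT (EFin \o (fun w => th * (expR (th * block_sum j w)
    * block_avg j w))).
  exact: (@integrableZl _ _ _ P _ measurableT _ _ iUA).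
apply: (@le_trans _ _ (\int[P]_w ((1 + 2 * th ^+ 2) * expR (th * block_sum j w)
    +
    th * (expR (th * block_sum j w) * block_avg j w)))).
  apply: le_Rintegral => //.
  - apply: (@bounded_integrable _ _ _ _ _ (expR j.+1%:R)).
      exact: (past_measurableW GY (@past_exp_block_sum j.+1)).
    by move=> w; have /andP[? ?] := exp_block_sum_bounded j.+1 w;
        rewrite ger0_norm.
  - exact: (integrableD _ i1 i2).
  - move=> w _; rewrite /block_sum big_ord_recr/= -/(block_sum j w) mulrDr
      expRD.
    have A1 := norm_block_avg_le1 j w.
    have thA : `|th * block_avg j w| <= 1.
      by rewrite normrM (ger0_norm th0) mulr_ile1.
    have := expR_le_quadratic thA.
    have A2 : block_avg j w ^+ 2 <= 1 by rewrite -real_normK ?num_real//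
        exprn_ile1.
    rewrite exprMn => q.
    have q' : expR (th * block_avg j w) <= 1 + th * block_avg j w + 2 * th ^+ 2.
      by apply: (le_trans q); rewrite lerD2l ler_wpM2l// ler_piMr// sqr_ge0.
    have -> : (1 + 2 * th ^+ 2) * expR (th * block_sum j w) +
        th * (expR (th * block_sum j w) * block_avg j w) =
        expR (th * block_sum j w) * (1 + th * block_avg j w + 2 * th ^+ 2) by
            ring.
    by rewrite ler_pM2l ?expR_gt0.
rewrite RintegralD// RintegralZl// RintegralZl// -/(E j) [leRHS]mulrDl lerD2l
    -mulrA.
by rewrite ler_wpM2l// exp_block_sum_avg_le.
Qed.

Lemma exp_block_sum_le :
  \int[P]_w expR (th * block_sum n w) <=
  expR (n%:R * (2 * th ^+ 2 + th * (N%:R^-1 + 2 * eps))).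
Proof.
set q := 2 * th ^+ 2 + _.
have q0 : 0 <= 1 + q.
  have nN : (n * N)%:R^-1 <= (1 : R).
    by rewrite invf_le1 ?ltr0n ?muln_gt0 ?n0// ler1n muln_gt0 n0.
  have eps0 : 0 <= eps.
    apply: le_trans (eps_bound (lexx 0) _ (lexx 1)); last by rewrite add0r.
    by rewrite !mulr_ge0// ?pi_ge0// invr_ge0 mulr_ge0// sqrtr_ge0.
  by rewrite addr_ge0// addr_ge0 ?mulr_ge0 ?sqr_ge0// addr_ge0// mulr_ge0.
have H j : (j <= n)%N -> E j <= (1 + q) ^+ j.
  elim: j => [_|j IH jn].
    rewrite expr0 /E (_ : (fun w => _) = fun=> 1) ?Rintegral_cst_prob//.
    by apply/funext => w; rewrite /block_sum big_ord0 mulr0 expR0.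
  rewrite exprS; apply: le_trans (exp_block_sum_step jn) _.
  by rewrite -addrA ler_wpM2l// IH// ltnW.
apply: le_trans (H n (leqnn n)) _.
rewrite mulrC expRM_natr lerXn2r ?nnegrE ?expR_ge0//.
exact: expR_ge1Dx.
Qed.

End exponential_moment.

(** * Almost sure bounds from summable expectations *)

Section ae_bound.
Context d (Omega : measurableType d) (R : realType) (P : {measure set Omega ->
    \bar R}).

(** By Fatou's lemma and monotone convergence, the series over [l] of the lower
    limits in [m] has a finite expectation. It is then almost surely finite and
    bounds each of its terms. *)
Lemma ae_bounded_of_summable_expectation (Z : nat -> nat -> Omega -> R) (b : nat
    -> R) C :
  (forall l m, measurable_fun setT (Z l m)) -> (forall l m w, 0 <= Z l m w) ->
  (forall l m, (\int[P]_w (Z l m w)%:E <= (b l)%:E)%E) ->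
  (forall n, \sum_(l < n) b l <= C) ->
  {ae P, forall w, exists K : R, forall l z, Z l m w @[m --> \oo] --> z -> z <=
      K}.
Proof.
move=> mZ Z0 Zb bC.
pose L l w := limn_einf (fun m => (Z l m w)%:E).
have mL l : measurable_fun setT (L l).
  apply: (@emeasurable_fun_cvg _ _ _ _ (fun n w => einfs (fun m => (Z l m w)%:E)
      n)).
    by apply: measurable_fun_einfs => m; exact/measurable_EFinP.
  by move=> w _; rewrite /L limn_einf_lim; exact: is_cvg_einfs.
have L0 l w : (0 <= L l w)%E.
  rewrite /L limn_einf_lim; apply: lime_ge; first exact: is_cvg_einfs.
  apply: nearW => n; apply: le_ereal_inf_tmp => _ [m /= _ <-].
  by rewrite lee_fin.
pose f w := (\sum_(l <oo) L l w)%E.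
have mf : measurable_fun setT f by exact: ge0_emeasurable_sum.
have f0 w : (0 <= f w)%E by exact: nneseries_ge0.
have fC : (\int[P]_w f w <= C%:E)%E.
  rewrite integral_nneseries//.
  apply: lime_le; first by apply: is_cvg_nneseries => n _ _;
      exact: integral_ge0.
  apply: nearW => n; rewrite big_mkord.
  apply: (@le_trans _ _ (\sum_(l < n) b l)%:E); last by rewrite lee_fin.
  rewrite -sumEFin; apply: lee_sum => l _.
  apply: le_trans (fatou P measurableT _ _) _.
  - by move=> m; exact/measurable_EFinP.
  - by move=> m w _; rewrite lee_fin.
  rewrite limn_einf_lim; apply: lime_le; first exact: is_cvg_einfs.
  apply: nearW => k; apply: le_trans (Zb l k).
  by apply: ereal_inf_lbound; exists k => /=.
have intf : P.-integrable setT f.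
  apply/integrableP; split => //.
  under eq_integral do rewrite gee0_abs//.
  by apply: le_lt_trans fC _; rewrite ltry.
have := integrable_ae measurableT intf; apply: filterS => w /(_ I) fw.
exists (fine (f w)) => l z Zz.
rewrite -lee_fin fineK//.
have <- : L l w = z%:E.
  have Zz' : (fun m => (Z l m w)%:E) @ \oo --> z%:E by apply: cvg_comp Zz _.
  exact: (cvg_limn_einf_sup Zz').1.
apply: (@le_trans _ _ (\sum_(0 <= i < l.+1) L i w)%E).
  by rewrite big_nat_recr//= leeDr// sume_ge0.
by apply: (nneseries_lim_ge (P := xpredT)) => n _ _.
Qed.

(** A telescoping series comparable with the series of [1 / l ^ 2]. *)
Definition summable_weight (l : nat) : R := (l.+1%:R * l.+2%:R)^-1.

Lemma sum_summable_weight n : \sum_(l < n) summable_weight l = 1 - n.+1%:R^-1.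
Proof.
elim: n => [|n IH]; first by rewrite big_ord0 invr1 subrr.
rewrite big_ord_recr/= IH /summable_weight.
have a0 : n.+1%:R != 0 :> R by rewrite pnatr_eq0.
have b0 : n.+2%:R != 0 :> R by rewrite pnatr_eq0.
have -> : n.+2%:R = n.+1%:R + 1 :> R by rewrite -natr1.
rewrite -natr1 in b0; move: (n.+1%:R : R) a0 b0 => a a0 b0.
by field; apply/andP; split.
Qed.

Lemma sum_summable_weight_le1 n C : 0 <= C -> \sum_(l < n) C * summable_weight l
    <= C.
Proof.
by move=> C0; rewrite -mulr_sumr sum_summable_weight ler_piMr// lerBlDr lerDl
    invr_ge0.
Qed.

End ae_bound.

(** * Frequencies dominated by randomness *)

Section riemann_blocks.
Context {R : realType}.
Notation mu := (@lebesgue_measure R).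

(** The integrand may change from block to block, as it does when the path is
    compared with its value at the left end of the block. *)
Lemma riemann_blocks_cvg (F : nat -> R -> R) (n N : nat) :
  (0 < n)%N -> (0 < N)%N -> (forall j, continuous (F j)) ->
  \sum_(j < n) ((N * m.+1)%:R^-1 * \sum_(k < (N * m.+1)%N) F j (grid R n N m.+1
      (j * (N * m.+1) + k)))
    @[m --> \oo] -->
  n%:R * \sum_(j < n) \int[mu]_(t in `[0 + j%:R * n%:R^-1, 0 + j.+1%:R *
      n%:R^-1]) F j t.
Proof.
move=> n0 N0 cF.
have nR : n%:R != 0 :> R by rewrite pnatr_eq0 -lt0n.
rewrite mulr_sumr; apply: cvg_big => [|j _]; first exact: add_continuous.
have := @riemann_sum_cvg R (F j) (0 + j%:R * n%:R^-1) n%:R^-1.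
rewrite invr_ge0 ler0n => /(_ isT (cF j)).
have -> : 0 + j%:R * n%:R^-1 + n%:R^-1 = 0 + j.+1%:R * n%:R^-1 :> R.
  by rewrite -(natr1 j) mulrDl mul1r addrA.
(* [(f m).+1] runs through the multiples of [N]. *)
move=> H; pose f m := (N * m.+1).-1.
have fE m : (f m).+1 = (N * m.+1)%N by rewrite /f prednK// muln_gt0 N0.
have foo : f m @[m --> \oo] --> \oo.
  move=> A [M _ HM]; exists M => // m /= Mm; apply: HM => /=.
  rewrite -ltnS fE; apply: leq_ltn_trans Mm _; exact: leq_pmull.
have := cvg_comp _ _ foo H => {}H.
have -> : (fun m => (N * m.+1)%:R^-1 * \sum_(k < (N * m.+1)%N) F j (grid R n N
    m.+1 (j * (N * m.+1) + k)))
   = (fun m => n%:R * ((f m).+1%:R^-1 *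
     (\sum_(k < (f m).+1) F j (0 + j%:R / n%:R + k%:R * (n%:R^-1 / (f
         m).+1%:R))) / n%:R)).
  apply/funext => m; rewrite fE [RHS]mulrC divfK//; congr (_ * _).
  apply: eq_bigr => k _; congr (F j _).
  rewrite /grid natrD !natrM; field; rewrite nR.
  by rewrite addrC natr1 !pnatr_eq0 (gtn_eqF N0).
by apply: cvgM; [exact: cvg_cst|exact: H].
Qed.

Lemma riemann_blocks_cvgT (F : R -> R) (n N : nat) :
  (0 < n)%N -> (0 < N)%N -> continuous F ->
  \sum_(j < n) ((N * m.+1)%:R^-1 * \sum_(k < (N * m.+1)%N) F (grid R n N m.+1 (j
      * (N * m.+1) + k)))
    @[m --> \oo] -->
  n%:R * \int[mu]_(t in `[0, 1]) F t.
Proof.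
move=> n0 N0 cF; have := riemann_blocks_cvg n0 N0 (fun=> cF).
rewrite -Rintegral_itv_sum//.
by rewrite add0r divff// pnatr_eq0 -lt0n.
Qed.

End riemann_blocks.

Section finite_sums.
Context d (Omega : measurableType d) (R : realType) (P : {measure set Omega ->
    \bar R}).

Lemma measurable_sum_cond n (p : pred 'I_n) (f : 'I_n -> Omega -> R) :
  (forall i, measurable_fun setT (f i)) ->
  measurable_fun setT (fun w => \sum_(i < n | p i) f i w).
Proof.
move=> mf; rewrite (_ : (fun w => _) = fun w => \sum_(i < n) (if p i then f i w
    else 0)).
  by apply: measurable_sum => i; case: (p i) => //; exact: measurable_cst.
by apply/funext => w; rewrite big_mkcond.
Qed.

Lemma ge0_integral_sum_le n (p : pred 'I_n) (f : 'I_n -> Omega -> R) c :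
  (forall i, measurable_fun setT (f i)) -> (forall i w, 0 <= f i w) -> 0 <= c ->
  (forall i, p i -> (\int[P]_w (f i w)%:E <= c%:E)%E) ->
  (\int[P]_w (\sum_(i < n | p i) f i w)%:E <= (n%:R * c)%:E)%E.
Proof.
move=> mf f0 c0 fc.
have -> : (\int[P]_w (\sum_(i < n | p i) f i w)%:E =
    \int[P]_w (\sum_(i < n) (if p i then f i w else 0)%:E))%E.
  by apply: eq_integral => w _; rewrite sumEFin -big_mkcond.
rewrite ge0_integral_sum//; last 2 first.
- move=> i; apply/measurable_EFinP; case: (p i) => //; exact: measurable_cst.
- by move=> i w _; rewrite lee_fin; case: ifP.
have -> : n%:R * c = \sum_(i < n) c by rewrite sumr_const card_ord mulr_natl.
rewrite -sumEFin; apply: lee_sum => i _; case: (boolP (p i)) => [/fc//|_].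
by rewrite integral0 lee_fin.
Qed.

End finite_sums.

Section high_frequency.
Context d (Omega : measurableType d) (R : realType) (P : probability Omega R).
Variables (Y : R -> Omega -> R) (v : R -> R) (kappa : R) (q Q : nat).
Hypothesis GY : gaussian_increments P Y v.
Hypothesis kappa0 : 0 < kappa.
Hypothesis vq : forall s t, 0 <= s -> s < t -> t <= 1 ->
  kappa * (t - s) ^+ q <= v t - v s.
Notation mu := (@lebesgue_measure R).

(** At lag [1 / N ^ 4] the standard deviation is at least of order
    [N ^ (- 2 q)]. The exponent [2 q + 1] of the frequency leaves a gain of
    [1 / N]. *)
Lemma char_eps_bound (N : nat) (y : R) s t : (0 < N)%N ->
  N%:R ^+ (2 * q).+1 / 2 <= `|y| ->
  0 <= s -> s + (N ^ 3 * N)%:R^-1 <= t -> t <= 1 ->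
  2 * pi / (`|y| * Num.sqrt (v t - v s)) <= 4 * pi / Num.sqrt kappa / N%:R.
Proof.
move=> N0 yN s0 st t1.
have NR : (0 : R) < N%:R by rewrite ltr0n.
have N4 : 0 < (N ^ 3 * N)%:R^-1 :> R by rewrite invr_gt0 ltr0n muln_gt0 expn_gt0
    N0.
have lt_st : s < t by apply: lt_le_trans st; rewrite ltrDl.
have k0 : 0 < Num.sqrt kappa by rewrite sqrtr_gt0.
have sq : Num.sqrt kappa * N%:R ^- (2 * q) <= Num.sqrt (v t - v s).
  have -> : N%:R ^- (2 * q) = Num.sqrt ((N%:R ^- (2 * q)) ^+ 2) :> R.
    by rewrite sqrtr_sqr ger0_norm// invr_ge0 exprn_ge0// ltW.
  rewrite -sqrtrM ?(ltW kappa0)// ler_wsqrtr//;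
      apply: le_trans (vq s0 lt_st t1).
  rewrite ler_pM2l//.
  have -> : (N%:R ^- (2 * q)) ^+ 2 = ((N ^ 3 * N)%:R^-1) ^+ q :> R.
    rewrite -expnSr natrX !exprVn; congr (_^-1); rewrite -!exprM;
        congr (_ ^+ _).
    by rewrite mulnAC.
  by rewrite lerXn2r ?nnegrE ?subr_ge0 ?(ltW N4) ?(ltW lt_st)// lerBrDl.
have p0 := @pi_gt0 R.
have A0 : 0 < N%:R ^+ (2 * q).+1 / 2 * (Num.sqrt kappa * N%:R ^- (2 * q)) :> R.
  by rewrite mulr_gt0 ?divr_gt0 ?exprn_gt0 ?mulr_gt0 ?invr_gt0 ?exprn_gt0.
apply: (@le_trans _ _ (2 * pi / (N%:R ^+ (2 * q).+1 / 2 * (Num.sqrt kappa * N%:R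
    ^- (2 * q))))).
  have le : N%:R ^+ (2 * q).+1 / 2 * (Num.sqrt kappa * N%:R ^- (2 * q)) <= `|y|
      * Num.sqrt (v t - v s).
    by rewrite ler_pM// ?divr_ge0 ?exprn_ge0 ?mulr_ge0 ?invr_ge0 ?exprn_ge0//
        ltW.
  rewrite ler_wpM2l//; first by rewrite mulr_ge0// ltW.
  by rewrite lef_pV2 ?posrE//; exact: lt_le_trans le.
rewrite le_eqVlt; apply/orP; left; apply/eqP; rewrite exprS.
by field; rewrite !gt_eqF//= exprn_gt0.
Qed.

(** The lattice has spacing [1 / (2 N)] and must reach
    [(N + 1) ^ Q <= (2 N) ^ Q]. *)
Definition half_range (N : nat) : nat := (2 ^ Q.+1 * N ^ Q.+1)%N.
Definition lattice (N : nat) (i : nat) : R := (i%:R - (half_range N)%:R) / (2 *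
    N%:R).
Definition lattice_size (N : nat) : nat := (2 * half_range N).+1.
(** The factor [1 / 2] leaves room for rounding a frequency to the lattice. *)
Definition high (N i : nat) : bool := N%:R ^+ (2 * q).+1 / 2 <= `|lattice N i|.
(** The four phases turn the cosine into plus or minus the cosine and the sine,
    so that upper bounds on the four integrals bound the complex integral. *)
Definition phase (b : nat) : R := b%:R * (pi / 2).

Let C1 : R := 3 + 8 * pi / Num.sqrt kappa.

Let Z (l m : nat) (w : Omega) : R :=
  \sum_(b < 4) \sum_(i < lattice_size l.+1)
  \sum_(i' < lattice_size l.+1 | high l.+1 i')
  expR (l.+1%:R^-1 * block_sum Y (l.+1 ^ 3) l.+1 m.+1 (phase b) (lattice l.+1 i)
      (lattice l.+1 i') (l.+1 ^ 3) w
    - l.+1%:R * (C1 + 2)).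

Lemma power_le_expR D (x : R) : 0 <= x -> x ^+ D <= D`!%:R * expR x.
Proof.
move=> x0; case: D => [|D].
  by rewrite expr0 fact0 mul1r; have := expR_ge1Dx x; lra.
have := expR_ge1Dxn D x0; rewrite -ler_pdivrMl ?ltr0n ?fact_gt0//.
by rewrite mulrC; lra.
Qed.

Lemma high_neq0 l i : high l.+1 i -> lattice l.+1 i != 0.
Proof.
rewrite /high => h; rewrite -normr_gt0; apply: lt_le_trans h.
by rewrite divr_gt0// exprn_gt0// ltr0n.
Qed.

(** With blocks of length [1 / N ^ 3] and parameter [1 / N], the exponent in
    [exp_block_sum_le] is linear in [N]; it is subtracted together with [2 N],
    which leaves a factor [exp (- 2 N)]. *)
Lemma integral_high_term l m b i i' : high l.+1 i' ->
  (\int[P]_w (expR (l.+1%:R^-1 * block_sum Y (l.+1 ^ 3) l.+1 m.+1 (phase b)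
      (lattice l.+1 i) (lattice l.+1 i') (l.+1 ^ 3) w
    - l.+1%:R * (C1 + 2)))%:E <= (expR (- (2 * l.+1%:R)))%:E)%E.
Proof.
move=> hi; set N := l.+1; set S := block_sum _ _ _ _ _ _ _ _.
have N0 : (0 < N)%N by [].
have NR : (0 : R) < N%:R by rewrite ltr0n.
have th0 : (0 : R) <= N%:R^-1 by rewrite invr_ge0 ltW.
have th1 : N%:R^-1 <= (1 : R) by rewrite invf_le1// ler1n.
have n0 : (0 < N ^ 3)%N by rewrite expn_gt0.
have := exp_block_sum_le GY (phase b) (lattice N i) n0 N0 (ltn0Sn m) th0 th1
    (high_neq0 hi)
  (fun s t => @char_eps_bound N _ s t N0 hi).
rewrite -/S => H.
have SM w : `|expR (N%:R^-1 * S w)| <= expR (N ^ 3)%:R.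
  have /andP[h0 h1] := exp_block_sum_bounded Y (N ^ 3)
    (phase b) (lattice N i) (lattice N i') N0 (ltn0Sn m) th0 th1 (N ^ 3) w.
  by rewrite ger0_norm.
have mS : measurable_fun setT (fun w => expR (N%:R^-1 * S w)).
  exact: (past_measurableW GY (@past_exp_block_sum _ _ _ _ _ _ GY (N ^ 3) N m.+1
      _ _ _ _ (N ^ 3))).
have iS := bounded_integrable P mS SM.
have -> : (\int[P]_w (expR (N%:R^-1 * S w - N%:R * (C1 + 2)))%:E =
   (\int[P]_w (expR (N%:R^-1 * S w))%:E) * (expR (- (N%:R * (C1 + 2))))%:E)%E.
  rewrite -ge0_integralZr//; last exact/measurable_EFinP.
  by apply: eq_integral => w _; rewrite expRD EFinM.
rewrite -[X in (X * _)%E]fineK; last exact: integrable_fin_num.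
rewrite -EFinM lee_fin; apply: (@le_trans _ _ (expR (N%:R * C1) * expR (- (N%:R
    * (C1 + 2))))).
  rewrite ler_wpM2r ?expR_ge0//; apply: (le_trans H); rewrite ler_expR natrX.
  rewrite le_eqVlt; apply/orP; left; apply/eqP; rewrite /C1.
  by field; rewrite !gt_eqF// sqrtr_gt0.
by rewrite -expRD ler_expR; lra.
Qed.

Let mterm l m b i i' : measurable_fun setT (fun w => expR (l.+1%:R^-1 *
    block_sum Y (l.+1 ^ 3) l.+1 m.+1 (phase b) (lattice l.+1 i) (lattice l.+1
        i') (l.+1 ^ 3) w
    - l.+1%:R * (C1 + 2))).
Proof.
have mB := past_measurableW GY (@past_block_sum _ _ _ _ _ _ GY (l.+1 ^ 3) l.+1
    m.+1
  (phase b) (lattice l.+1 i) (lattice l.+1 i') (l.+1 ^ 3)).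
have me : measurable_fun [set: R] (fun z : R => expR (l.+1%:R^-1 * z - l.+1%:R *
    (C1 + 2))).
  apply: continuous_measurable_fun => z; apply: continuous_comp;
      last exact: continuous_expR.
  apply: cvgB; last exact: cvg_cst.
  by apply: cvgM; [exact: cvg_cst|exact: cvg_id].
exact: (measurableT_comp me mB).
Qed.

Let ZC : R := 72 * (2 ^ Q.+1)%:R ^+ 2 * (2 * Q + 4)`!%:R.

Lemma lattice_size_le N : (0 < N)%N -> (lattice_size N <= 3 * half_range N)%N.
Proof.
move=> N0; have : (0 < half_range N)%N by rewrite muln_gt0 !expn_gt0 N0.
by rewrite /lattice_size; lia.
Qed.

(** The factor [exp (- 2 N)] beats the polynomial number of lattice points. *)
Lemma integral_high_le l m : (\int[P]_w (Z l m w)%:E <= (ZC * summable_weight R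
    l)%:E)%E.
Proof.
set N := l.+1; set L := lattice_size N; set e := expR (- (2 * N%:R)) : R.
have e0 : 0 <= e by exact: expR_ge0.
apply: (@le_trans _ _ (4 * (L%:R * (L%:R * e)))%:E).
  apply: ge0_integral_sum_le => [b|b w||b _].
  - by apply: measurable_sum => i; apply: measurable_sum_cond => i';
      exact: mterm.
  - by apply: sumr_ge0 => i _; apply: sumr_ge0 => i' _; exact: expR_ge0.
  - by rewrite !mulr_ge0.
  apply: ge0_integral_sum_le => [i|i w||i _].
  - by apply: measurable_sum_cond => i'; exact: mterm.
  - by apply: sumr_ge0 => i' _; exact: expR_ge0.
  - by rewrite !mulr_ge0.
  apply: ge0_integral_sum_le => [i'|i' w||i' hi].
  - exact: mterm.
  - exact: expR_ge0.
  - by [].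
  - exact: integral_high_term.
rewrite lee_fin /summable_weight ler_pdivlMr ?mulr_gt0 ?ltr0n//.
have NR : (0 : R) < N%:R by rewrite ltr0n.
have N1 : (1 : R) <= N%:R by rewrite ler1n.
have l2 : l.+2%:R <= 2 * N%:R :> R by rewrite -natrM ler_nat /N; lia.
pose H : R := (2 ^ Q.+1)%:R * N%:R ^+ Q.+1.
have LH : L%:R <= 3 * H :> R.
  by rewrite /H -natrX -!natrM ler_nat lattice_size_le.
have H0 : 0 <= H by rewrite mulr_ge0// exprn_ge0// ltW.
have eN : N%:R ^+ (2 * Q + 4) * e <= (2 * Q + 4)`!%:R.
  have := power_le_expR (2 * Q + 4) (ltW NR).
  move=> h; apply: (@le_trans _ _ ((2 * Q + 4)`!%:R * expR N%:R * e)).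
    by rewrite ler_wpM2r.
  rewrite -mulrA ler_piMr// /e -expRD -[leRHS]expR0 ler_expR; lra.
apply: (@le_trans _ _ (4 * (3 * H * (3 * H * e)) * (N%:R * (2 * N%:R)))).
  apply: ler_pM; rewrite ?mulr_ge0//.
    rewrite ler_pM2l//; apply: ler_pM; rewrite ?mulr_ge0//.
    by rewrite ler_wpM2r.
  by rewrite ler_pM2l.
have -> : 4 * (3 * H * (3 * H * e)) * (N%:R * (2 * N%:R)) =
   72 * (2 ^ Q.+1)%:R ^+ 2 * (N%:R ^+ (2 * Q + 4) * e).
  have -> : N%:R ^+ (2 * Q + 4) = (N%:R ^+ Q.+1) ^+ 2 * N%:R ^+ 2 :> R.
    by rewrite -exprM -exprD; congr (_ ^+ _); rewrite mulSn mulnC; lia.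
  by rewrite /H; ring.
by rewrite /ZC ler_wpM2l// mulr_ge0// sqr_ge0.
Qed.

(** If [exp (N ^ 2 I - N (C1 + 2))] is at most [K] for all [N], where [I] is the
    integral, then [I] is of order [1 / N]. *)
Lemma high_frequency_bound : {ae P, forall w, continuous (Y ^~ w) ->
  exists K : R, forall l b i i', (b < 4)%N -> (i < lattice_size l.+1)%N ->
    (i' < lattice_size l.+1)%N -> high l.+1 i' ->
  \int[mu]_(t in `[0, 1]) cos (phase b + lattice l.+1 i * t + lattice l.+1 i' *
      Y t w)
    <= K / l.+1%:R}.
Proof.
have ZC0 : 0 <= ZC by rewrite !mulr_ge0.
have mZ l m : measurable_fun setT (Z l m).
  apply: measurable_sum => b; apply: measurable_sum => i;
      apply: measurable_sum_cond => i'.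
  exact: mterm.
have Z0 l m w : 0 <= Z l m w.
  by do 3 (apply: sumr_ge0 => ? _); exact: expR_ge0.
have := ae_bounded_of_summable_expectation mZ Z0 integral_high_le
  (fun n => sum_summable_weight_le1 n ZC0).
apply: filterS => w [K HK] cY.
exists (C1 + 2 + `|ln K|) => l b i i' b4 iL i'L hi.
set N := l.+1; have NR : (0 : R) < N%:R by rewrite ltr0n.
have N1 : (1 : R) <= N%:R by rewrite ler1n.
pose I b i i' := \int[mu]_(t in `[0, 1]) cos (phase b + lattice N i * t +
    lattice N i' * Y t w).
pose z b i i' := expR (N%:R^-1 * ((N ^ 3)%:R * I b i i') - N%:R * (C1 + 2)).
have zc : Z l m w @[m --> \oo] -->
    \sum_(b < 4) \sum_(i < lattice_size N) \sum_(i' < lattice_size N | high N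
        i') z b i i'.
  apply: cvg_big => [|b' _]; first exact: add_continuous.
  apply: cvg_big => [|j _]; first exact: add_continuous.
  apply: cvg_big => [|j' _]; first exact: add_continuous.
  apply: (cvg_comp _ expR); last exact: continuous_expR.
  apply: cvgB; last exact: cvg_cst.
  apply: cvgM; first exact: cvg_cst.
  apply: (@riemann_blocks_cvgT R (fun t => cos (phase b' + lattice N j * t +
      lattice N j' * Y t w))) => //.
  move=> t; apply: continuous_comp; last exact: continuous_cos.
  apply: cvgD; last by apply: cvgM; [exact: cvg_cst|exact: cY].
  by apply: cvgD; [exact: cvg_cst|apply: cvgM; [exact: cvg_cst|exact: cvg_id]].
have := HK l _ zc => zK.
have zK' : z b i i' <= K.
  apply: le_trans zK.
  rewrite (bigD1 (Ordinal b4))//= (bigD1 (Ordinal iL))//= (bigD1 (Ordinal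
      i'L))//=.
  rewrite -!addrA lerDl !addr_ge0//; repeat (apply: sumr_ge0 => ? _) => //;
      exact: expR_ge0.
(* The constant is a sum of exponentials, so its logarithm makes sense. *)
have K0 : 0 < K by apply: lt_le_trans zK'; exact: expR_gt0.
rewrite ler_pdivlMr// -/(I b i i').
have : N%:R^-1 * ((N ^ 3)%:R * I b i i') - N%:R * (C1 + 2) <= ln K.
  by rewrite -ler_expR lnK.
have -> : N%:R^-1 * ((N ^ 3)%:R * I b i i') = N%:R * (I b i i' * N%:R).
  by rewrite natrX; field; rewrite gt_eqF.
rewrite -mulrBr => h.
have : I b i i' * N%:R - (C1 + 2) <= `|ln K|.
  have [h0|h0] := leP (I b i i' * N%:R - (C1 + 2)) 0.
    exact: le_trans h0 _.
  apply: le_trans (ler_norm _); apply: le_trans h.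
  by rewrite ler_peMl// ltW.
lra.
Qed.

End high_frequency.

(** * Displacement of the path inside short blocks *)

Section low_frequency.
Context d (Omega : measurableType d) (R : realType) (P : probability Omega R).
Variables (Y : R -> Omega -> R) (v : R -> R) (p : nat).
Hypothesis GY : gaussian_increments P Y v.
Notation mu := (@lebesgue_measure R).

Lemma gi_variance_le s t : 0 <= s -> s <= t -> t <= 1 -> v s <= v t.
Proof.
move=> s0; rewrite le_eqVlt => /predU1P[->//|st] t1.
by have [/ltW] := gi_law GY s0 st t1.
Qed.

Lemma abs_increment_expectation_le s t : 0 <= s -> s <= t -> t <= 1 ->
  (\int[P]_w (`|Y t w - Y s w|)%:E <= (Num.sqrt 2 * Num.sqrt (v t - v s))%:E)%E.
Proof.
move=> s0; rewrite le_eqVlt => /predU1P[->|st] t1.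
  rewrite subrr sqrtr0 mulr0.
  by under eq_integral do rewrite subrr normr0; rewrite integral0.
have [vst law] := gi_law GY s0 st t1.
have mD : @measurable_fun _ _ Omega (measurableTypeR R) setT (fun w => Y t w - Y
    s w).
  exact: (measurable_increment GY).
pose D : {RV P >-> measurableTypeR R} := HB.pack (fun w => Y t w - Y s w)
  (isMeasurableFun.Build _ _ _ _ _ mD).
have mabs : measurable_fun setT (fun x : measurableTypeR R => (`|x|)%:E).
  by apply/measurable_EFinP; exact: normr_measurable.
have -> : (\int[P]_w (`|Y t w - Y s w|)%:E =
    \int[normal_prob 0 (Num.sqrt (v t - v s))]_x (`|x|)%:E)%E.
  transitivity (\int[distribution P D]_x (`|x|)%:E)%E; last first.
    by apply: eq_measure_integral => A mA _; exact: law.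
  by rewrite ge0_integral_distribution.
by apply: normal_prob_abs_moment; rewrite sqrtr_gt0 subr_gt0.
Qed.

(** The square root of the variance is linearized so that it can be summed over
    blocks; [g] will be the square root of the length of a block. *)
Lemma abs_increment_expectation_AMGM s t g : 0 <= s -> s <= t -> t <= 1 -> 0 < g
    ->
  (\int[P]_w (`|Y t w - Y s w|)%:E <= (g + (v t - v s) / g)%:E)%E.
Proof.
move=> s0 st t1 g0; apply: le_trans (abs_increment_expectation_le s0 st t1) _.
rewrite lee_fin; set a := Num.sqrt (v t - v s).
have -> : v t - v s = a ^+ 2 by rewrite sqr_sqrtr// subr_ge0 gi_variance_le.
have a0 : 0 <= a by exact: sqrtr_ge0.
apply: (@le_trans _ _ (2 * a)).
  by rewrite ler_wpM2r//; have := @sqrt2_le R; lra.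
have -> : g + a ^+ 2 / g = 2 * a + (g - a) ^+ 2 / g by field; rewrite gt_eqF.
by rewrite lerDl divr_ge0// ?sqr_ge0// ltW.
Qed.

(** With blocks of length [g ^ 2], the mean displacement is of order [g]. Here
    [g = N ^ (- (p + 3))]: multiplied by [|y| <= N ^ p] it must still be
    [1 / N], and two more powers are spent on summability. *)
Definition block_count (N : nat) : nat := (N ^ (2 * (p + 3)))%N.
Definition node (H j : nat) : R := 0 + j%:R * H%:R^-1.

Definition path_block_error (f : R -> R) (N : nat) : R :=
  \sum_(j < block_count N) \int[mu]_(t in `[node (block_count N) j, node
      (block_count N) j.+1])
    `|f t - f (node (block_count N) j)|.

Let H l := block_count l.+1.
Let a l m : R := l.+1%:R ^+ p.+1 * (H l)%:R^-1 * (1 * m.+1)%:R^-1.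
Let Z (l m : nat) (w : Omega) : R :=
  \sum_(j < H l) \sum_(k < (1 * m.+1)%N)
    a l m * `|Y (grid R (H l) 1 m.+1 (j * (1 * m.+1) + k)) w - Y (node (H l) j)
        w|.

Let H0 l : (0 < H l)%N. Proof. by rewrite expn_gt0. Qed.

Lemma node01 l j : (j <= H l)%N -> 0 <= node (H l) j <= 1.
Proof.
move=> jH; rewrite /node add0r divr_ge0//= ler_pdivrMr ?ltr0n// mul1r ler_nat//.
Qed.

Lemma node_grid l m j k : (k <= m.+1)%N ->
  node (H l) j <= grid R (H l) 1 m.+1 (j * (1 * m.+1) + k) <= node (H l) j.+1.
Proof.
move=> km; rewrite mul1n /node /grid mul1n !add0r natrM.
have h0 : (0 : R) < (H l)%:R by rewrite ltr0n.
have m0 : (0 : R) < m.+1%:R by rewrite ltr0n.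
have -> : (j * m.+1 + k)%:R / ((H l)%:R * m.+1%:R) =
   (j%:R + k%:R / m.+1%:R) / (H l)%:R :> R.
  by rewrite natrD natrM; field; rewrite (gt_eqF h0) addrC natr1 (gt_eqF m0).
rewrite !ler_pM2r ?invr_gt0// lerDl divr_ge0//= -(natr1 j) lerD2l ler_pdivrMr//
    mul1r.
by rewrite ler_nat.
Qed.

Let V : R := 2 * (1 + (v 1 - v 0)).

(** The variances of the block increments telescope to [v 1 - v 0]. *)
Lemma integral_path_error_le l m : (\int[P]_w (Z l m w)%:E <= (V *
    summable_weight R l)%:E)%E.
Proof.
set N := l.+1; set h := H l.
have NR : (0 : R) < N%:R by rewrite ltr0n.
have hR : (0 : R) < h%:R by rewrite ltr0n; exact: H0.
have mR : (0 : R) < (1 * m.+1)%:R by rewrite ltr0n mul1n.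
have a0 : 0 <= a l m by rewrite /a !mulr_ge0 ?exprn_ge0 ?invr_ge0// ltW.
have mf t s : measurable_fun setT (fun w => (a l m * `|Y t w - Y s w|)%:E).
  apply/measurable_EFinP/measurable_funM => //; apply: measurableT_comp => //.
  exact: (measurable_increment GY).
have f0 t s w : (0 <= (a l m * `|Y t w - Y s w|)%:E)%E by rewrite lee_fin
    mulr_ge0.
pose g : R := N%:R ^- (p + 3).
have g0 : 0 < g by rewrite invr_gt0 exprn_gt0.
under eq_integral do rewrite /Z -sumEFin.
rewrite ge0_integral_sum//=; last 2 first.
- move=> j; under eq_fun do rewrite -sumEFin.
  by apply: emeasurable_sum => k; exact: mf.
- by move=> j w _; rewrite lee_fin; apply: sumr_ge0 => k _; rewrite mulr_ge0.
apply: (@le_trans _ _ (\sum_(j < h) ((1 * m.+1)%:R * (a l m * (g + (v (node h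
    j.+1) - v (node h j)) / g))))%:E).
  rewrite -sumEFin; apply: lee_sum => j _.
  under eq_integral do rewrite -sumEFin.
  rewrite ge0_integral_sum//=.
  have -> : (1 * m.+1)%:R * (a l m * (g + (v (node h j.+1) - v (node h j)) / g))
      =
     \sum_(k < (1 * m.+1)%N) (a l m * (g + (v (node h j.+1) - v (node h j)) /
         g)).
    by rewrite sumr_const card_ord mulr_natl.
  rewrite -sumEFin; apply: lee_sum => k _.
  under eq_integral do rewrite EFinM.
  rewrite ge0_integralZl//; last first.
    by apply/measurable_EFinP; apply: measurableT_comp => //;
        exact: (measurable_increment GY).
  rewrite [leRHS]EFinM; apply: lee_wpmul2l; first by rewrite lee_fin.
  have km : (k <= m.+1)%N by have := ltn_ord k; lia.
  have /andP[n1 n2] := node_grid l j km.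
  have /andP[j0 _] := node01 (ltnW (ltn_ord j)).
  have /andP[_ j1] := node01 (ltn_ord j).
  apply: le_trans (abs_increment_expectation_AMGM j0 n1 (le_trans n2 j1) g0) _.
  rewrite lee_fin lerD2l; apply: ler_wpM2r; first by rewrite invr_ge0 ltW.
  rewrite lerD2r; apply: gi_variance_le => //; exact: le_trans n1.
rewrite lee_fin -mulr_sumr -mulr_sumr big_split/= sumr_const card_ord
    -mulr_suml.
have -> : \sum_(j < h) (v (node h j.+1) - v (node h j)) = v 1 - v 0.
  rewrite -(big_mkord xpredT (fun j => v (node h j.+1) - v (node h j)))
      telescope_sumr//.
  by rewrite /node !add0r mul0r divff// gt_eqF.
have hE : h%:R = (N%:R ^+ (p + 3)) ^+ 2 :> R by rewrite natrX -exprM mulnC.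
have v01 : 0 <= v 1 - v 0 by rewrite subr_ge0 gi_variance_le.
have -> : (1 * m.+1)%:R * (a l m * (g *+ h + (v 1 - v 0) / g)) =
    N%:R ^- 2 * (1 + (v 1 - v 0)).
  rewrite /a -/N -/h -[g *+ h]mulr_natl hE /g mul1n exprD exprS.
  by field; rewrite addrC natr1 pnatr_eq0 /= !gt_eqF// exprn_gt0.
have -> : V * summable_weight R l = 2 * summable_weight R l * (1 + (v 1 - v 0))
    by rewrite /V; ring.
apply: ler_wpM2r; first exact: addr_ge0.
rewrite /summable_weight.
have l2 : l.+2%:R <= 2 * N%:R :> R by rewrite -natrM ler_nat /N; lia.
rewrite ler_pdivlMr ?mulr_gt0 ?ltr0n// mulrC ler_pdivrMr ?exprn_gt0//.
by rewrite expr2 -/N mulrCA ler_pM2l// mulrC.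
Qed.

Lemma low_frequency_bound : {ae P, forall w, continuous (Y ^~ w) ->
  exists K : R, forall l, l.+1%:R ^+ p.+1 * path_block_error (Y ^~ w) l.+1 <=
      K}.
Proof.
have V0 : 0 <= V by rewrite /V mulr_ge0// addr_ge0// subr_ge0 gi_variance_le.
have mZ l m : measurable_fun setT (Z l m).
  apply: measurable_sum => j; apply: measurable_sum => k.
  apply: measurable_funM => //; apply: measurableT_comp => //.
  exact: (measurable_increment GY).
have Z0 l m w : 0 <= Z l m w.
  apply: sumr_ge0 => j _; apply: sumr_ge0 => k _; rewrite mulr_ge0//.
  by rewrite /a !mulr_ge0 ?exprn_ge0 ?invr_ge0.
have := ae_bounded_of_summable_expectation mZ Z0 integral_path_error_le
  (fun n => sum_summable_weight_le1 n V0).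
apply: filterS => w [K HK] cY.
exists K => l; apply: (HK l).
pose F j t := `|Y t w - Y (node (H l) j) w|.
have cF j : continuous (F j).
  move=> t; apply: cvg_norm; apply: cvgB; [exact: cY|exact: cvg_cst].
have := @riemann_blocks_cvg R F (H l) 1 (H0 l) isT cF => cv.
have hR : (H l)%:R != 0 :> R by rewrite pnatr_eq0 -lt0n.
have -> : path_block_error (Y ^~ w) l.+1 =
   (H l)%:R^-1 * ((H l)%:R * \sum_(j < H l) \int[mu]_(t in `[0 + j%:R / (H
       l)%:R, 0 + j.+1%:R / (H l)%:R]) F j t).
  by rewrite mulrA mulVf// mul1r.
rewrite [X in _ --> X]mulrA.
have -> : (fun m => Z l m w) = (fun m => l.+1%:R ^+ p.+1 / (H l)%:R *
  \sum_(j < H l) ((1 * m.+1)%:R^-1 * \sum_(k < (1 * m.+1)%N) F j (grid R (H l) 1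
      m.+1 (j * (1 * m.+1) + k)))).
  apply/funext => m; rewrite /Z mulr_sumr; apply: eq_bigr => j _.
  by rewrite mulrA mulr_sumr; apply: eq_bigr => k _; rewrite /a.
by apply: cvgM; [exact: cvg_cst|exact: cv].
Qed.

End low_frequency.

(** * Decay of the oscillatory integral along a path *)

Section oscillatory_integral.
Context {R : realType}.
Variable (f : R -> R) (q : nat).
Hypothesis cf : continuous f.
Notation mu := (@lebesgue_measure R).
Implicit Types (c x y t : R).
Let p := (2 * q).+1.
Let Q := (2 * (p + 3)).+1.

(** With [c = 0] and [c = - pi / 2] this is the real part and, up to sign, the
    imaginary part of the Fourier transform of the image of Lebesgue measure on
    the graph of [f]. *)
Definition wave (c x y : R) : R := \int[mu]_(t in `[0, 1]) cos (c + x * t + y *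
    f t).

Lemma continuous_wave c x y : continuous (fun t : R => cos (c + x * t + y * f
    t)).
Proof.
move=> t; apply: continuous_comp; last exact: continuous_cos.
apply: cvgD; last by apply: cvgM; [exact: cvg_cst|exact: cf].
by apply: cvgD; [exact: cvg_cst|apply: cvgM; [exact: cvg_cst|exact: cvg_id]].
Qed.

Lemma waveDpi c x y : wave (pi + c) x y = - wave c x y.
Proof.
rewrite /wave (_ : (fun t => _) = fun t => (-1) * cos (c + x * t + y * f t)).
  by rewrite RintegralZl ?mulN1r//; apply: continuous_integrable;
      exact: continuous_wave.
by apply/funext => t; rewrite mulN1r -cosDpi; congr cos; ring.
Qed.

Lemma norm_wave_le c x y : `|wave c x y| <= `|wave 0 x y| + `|wave (pi / 2) x
    y|.
Proof.
have i1 := continuous_integrable 0 1 (@continuous_wave 0 x y).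
have i2 := continuous_integrable 0 1 (@continuous_wave (pi / 2) x y).
have -> : wave c x y = cos c * wave 0 x y + sin c * wave (pi / 2) x y.
  rewrite /wave -!RintegralZl// -RintegralD//; last 2 first.
  - exact: (@integrableZl _ _ _ mu _ _ (cos c) _ i1).
  - exact: (@integrableZl _ _ _ mu _ _ (sin c) _ i2).
  apply: eq_Rintegral => t _.
  have -> : c + x * t + y * f t = c + (0 + x * t + y * f t) by ring.
  have -> : pi / 2 + x * t + y * f t = (0 + x * t + y * f t) + pi / 2 by ring.
  by rewrite cosDpihalf cosD; ring.
apply: le_trans (ler_normD _ _) _; rewrite !normrM.
by apply: lerD; rewrite ler_piMl// ?cos_max ?sin_max.
Qed.

Lemma wave_lipschitz c x y x' y' M : (forall t, 0 <= t <= 1 -> `|f t| <= M) ->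
  `|wave c x y - wave c x' y'| <= `|x - x'| + `|y - y'| * M.
Proof.
move=> fM; rewrite /wave -RintegralB//; last 2 first.
- by apply: continuous_integrable; exact: continuous_wave.
- by apply: continuous_integrable; exact: continuous_wave.
rewrite -[leRHS]mulr1 -[X in _ <= _ * X](subr0 1);
    apply: le_norm_Rintegral_itv => //.
  by move=> t; apply: cvgB; exact: continuous_wave.
move=> t /[dup] t01 /andP[t0 t1]; apply: le_trans (cos_lipschitz _ _) _.
have -> : c + x * t + y * f t - (c + x' * t + y' * f t) = (x - x') * t + (y -
    y') * f t by ring.
apply: le_trans (ler_normD _ _) _; rewrite !normrM; apply: lerD.
  by rewrite ler_piMr// ger0_norm.
by rewrite ler_wpM2l// fM.
Qed.

Lemma lattice_approx (N : nat) (x : R) : (0 < N)%N -> `|x| <= N.+1%:R ^+ Q ->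
  exists2 i, (i < lattice_size Q N)%N & `|x - lattice R Q N i| <= (2 * N%:R)^-1.
Proof.
move=> N0 xN; have NR : (0 : R) < N%:R by rewrite ltr0n.
set G := half_range Q N.
have xG : `|2 * N%:R * x| <= G%:R.
  rewrite normrM ger0_norm; last by rewrite mulr_ge0// ltW.
  apply: (@le_trans _ _ (2 * N%:R * (2 * N%:R) ^+ Q)).
    rewrite ler_pM2l ?mulr_gt0//; apply: (le_trans xN).
    by rewrite lerXn2r ?nnegrE ?mulr_ge0// -natrM ler_nat; lia.
  by rewrite -exprS -natrM -natrX expnMn.
have g0 : 0 <= 2 * N%:R * x + G%:R.
  by have := lerNnormlW xG; lra.
have g1 : 2 * N%:R * x + G%:R <= (2 * G)%:R.
  by rewrite natrM; have := ler_normlW xG; lra.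
have /andP[t0 t1] := truncn_itv g0.
exists (Num.truncn (2 * N%:R * x + G%:R)).
  rewrite /lattice_size ltnS -/G -(ler_nat R); exact: le_trans g1.
rewrite /lattice -/G.
have -> : x - ((Num.truncn (2 * N%:R * x + G%:R))%:R - G%:R) / (2 * N%:R) =
   ((2 * N%:R * x + G%:R) - (Num.truncn (2 * N%:R * x + G%:R))%:R) / (2 * N%:R).
  by field; rewrite gt_eqF.
rewrite ger0_norm; last by rewrite divr_ge0 ?subr_ge0 ?mulr_ge0// ltW.
rewrite -[leRHS]mul1r ler_pM2r ?invr_gt0 ?mulr_gt0//.
by rewrite lerBlDl; apply: ltW; rewrite natr1.
Qed.

Lemma high_wave_le (K1 M : R) l x y :
  (forall t, 0 <= t <= 1 -> `|f t| <= M) ->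
  (forall b i i', (b < 4)%N -> (i < lattice_size Q l.+1)%N ->
    (i' < lattice_size Q l.+1)%N -> high R q Q l.+1 i' ->
  \int[mu]_(t in `[0, 1]) cos (phase R b + lattice R Q l.+1 i * t + lattice R Q
      l.+1 i' * f t)
    <= K1 / l.+1%:R) ->
  `|x| <= l.+2%:R ^+ Q -> `|y| <= l.+2%:R ^+ Q -> l.+1%:R ^+ p <= `|y| ->
  forall c, `|wave c x y| <= 2 * (K1 + 1 + M) / l.+1%:R.
Proof.
move=> fM H xQ yQ yp c; set N := l.+1 in H xQ yQ yp *.
have NR : (0 : R) < N%:R by rewrite ltr0n.
have N1 : (1 : R) <= N%:R by rewrite ler1n.
have [i iL xi] := @lattice_approx N x isT xQ.
have [i' i'L yi'] := @lattice_approx N y isT yQ.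
have M0 : 0 <= M by apply: le_trans (fM 0 _); rewrite ?lexx ?ler01.
have half1 : (2 * N%:R)^-1 <= 2^-1 :> R.
  by rewrite invfM ler_piMr// invf_le1.
have hi : high R q Q N i'.
  rewrite /high; have Np : (1 : R) <= N%:R ^+ (2 * q).+1 by rewrite exprn_ege1.
  have : `|y| <= `|y - lattice R Q N i'| + `|lattice R Q N i'|.
    by rewrite -{1}(subrK (lattice R Q N i') y) ler_normD.
  move: yp; rewrite -/p in Np *; move: yi' half1 Np; lra.
have main b : (b < 2)%N -> `|wave (phase R b) x y| <= (K1 + 1 + M) / N%:R.
  move=> b2.
  have h1 : wave (phase R b) (lattice R Q N i) (lattice R Q N i') <= K1 / N%:R.
    by apply: H => //; lia.
  (* Two phases further, the integral changes sign. *)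
  have h2 : - wave (phase R b) (lattice R Q N i) (lattice R Q N i') <= K1 /
      N%:R.
    rewrite -waveDpi; have -> : pi + phase R b = phase R (b + 2).
      by rewrite /phase natrD; field.
    by apply: H => //; lia.
  have := wave_lipschitz (phase R b) x y (lattice R Q N i) (lattice R Q N i')
      fM.
  have e : (2 * N%:R)^-1 <= N%:R^-1 :> R by rewrite lef_pV2 ?posrE ?mulr_gt0//;
      lra.
  have xi2 := le_trans xi e; have yi2 := le_trans yi' e.
  have yM : `|y - lattice R Q N i'| * M <= N%:R^-1 * M by rewrite ler_wpM2r.
  have e2 : (K1 + 1 + M) / N%:R = K1 / N%:R + N%:R^-1 + N%:R^-1 * M by ring.
  rewrite e2 => hl.
  have -> : wave (phase R b) x y = (wave (phase R b) x y - wave (phase R b)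
      (lattice R Q N i) (lattice R Q N i')) + wave (phase R b) (lattice R Q N i)
      (lattice R Q N i') by ring.
  apply: le_trans (ler_normD _ _) _.
  have : `|wave (phase R b) (lattice R Q N i) (lattice R Q N i')| <= K1 / N%:R.
    by rewrite ler_norml h1 andbT lerNl.
  lra.
apply: le_trans (norm_wave_le _ _ _) _.
have := main 0%N isT; have := main 1%N isT; rewrite /phase mul0r mul1r.
have -> : 2 * (K1 + 1 + M) / N%:R = (K1 + 1 + M) / N%:R + (K1 + 1 + M) / N%:R by
    ring.
lra.
Qed.

(** Freeze [f] at the left end of each block, then use [norm_Rintegral_cos_le]
    on each block. The number of blocks, [N ^ (Q - 1)], is small against
    [|x|]. *)
Lemma low_wave_le (K2 : R) l x y c :
  l.+1%:R ^+ p.+1 * path_block_error p f l.+1 <= K2 ->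
  l.+1%:R ^+ Q <= `|x| -> `|y| <= l.+1%:R ^+ p ->
  `|wave c x y| <= (2 + K2) / l.+1%:R.
Proof.
move=> HK xQ yp; set N := l.+1 in HK xQ yp *.
have NR : (0 : R) < N%:R by rewrite ltr0n.
set H := block_count p N.
have H0 : (0 < H)%N by rewrite expn_gt0.
have HR : (0 : R) < H%:R by rewrite ltr0n.
have x0 : 0 < `|x| by apply: lt_le_trans xQ; rewrite exprn_gt0.
have xn0 : x != 0 by rewrite -normr_gt0.
have dn j : 0 + j.+1%:R * H%:R^-1 = 0 + j%:R * H%:R^-1 + H%:R^-1 :> R.
  by rewrite -(natr1 j); ring.
have cabs z : continuous (fun t : R => `|f t - f z|).
  by move=> t; apply: cvg_norm; apply: cvgB; [exact: cf|exact: cvg_cst].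
have -> : wave c x y = \sum_(j < H)
    \int[mu]_(t in `[node R H j, node R H j.+1]) cos (c + x * t + y * f t).
  rewrite /wave /node -Rintegral_itv_sum//; last exact: continuous_wave.
  by rewrite add0r divff// gt_eqF.
apply: le_trans (ler_norm_sum _ _ _) _.
apply: (@le_trans _ _ (\sum_(j < H) (2 / `|x| + `|y| * \int[mu]_(t in `[node R H
    j, node R H j.+1]) `|f t - f (node R H j)|))).
  apply: ler_sum => j _; set u := node R H j; set u' := node R H j.+1.
  have uu' : u <= u' by rewrite /u /u' /node dn lerDl invr_ge0 ltW.
  have c0 : continuous (fun t : R => cos ((c + y * f u) + x * t)).
    move=> t; apply: continuous_comp; last exact: continuous_cos.
    by apply: cvgD; [exact: cvg_cst|apply: cvgM;
        [exact: cvg_cst|exact: cvg_id]].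
  have iw := continuous_integrable u u' (@continuous_wave c x y).
  have i0 := continuous_integrable u u' c0.
  have ia := continuous_integrable u u' (cabs u).
  have -> : \int[mu]_(t in `[u, u']) cos (c + x * t + y * f t) =
      \int[mu]_(t in `[u, u']) cos ((c + y * f u) + x * t) +
      \int[mu]_(t in `[u, u']) (cos (c + x * t + y * f t) - cos ((c + y * f u) +
          x * t)).
    by rewrite RintegralB//; ring.
  apply: le_trans (ler_normD _ _) _; apply: lerD;
      first exact: norm_Rintegral_cos_le.
  rewrite -RintegralZl//.
  have cd : continuous (fun t : R => cos (c + x * t + y * f t) - cos ((c + y * f
      u) + x * t)).
    by move=> t; apply: cvgB; [exact: continuous_wave|exact: c0].
  apply: le_trans (le_normr_Rintegral _ _) _ => //;
      first exact: continuous_integrable.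
  apply: le_Rintegral => //.
  - by apply: integrable_norm; exact: continuous_integrable.
  - exact: (@integrableZl _ _ _ mu _ _ `|y| _ ia).
  - move=> t _; apply: le_trans (cos_lipschitz _ _) _.
    by rewrite -normrM; have -> : c + x * t + y * f t - (c + y * f u + x * t) =
        y * (f t - f u) by ring.
rewrite big_split/= sumr_const card_ord -mulr_sumr -/(path_block_error p f N).
have E0 : 0 <= path_block_error p f N.
  by apply: sumr_ge0 => j _; apply: Rintegral_ge0.
have e1 : (2 / `|x|) *+ H <= 2 / N%:R.
  have HE : H%:R = N%:R ^+ (2 * (p + 3)) :> R by rewrite natrX.
  rewrite -mulr_natr mulrAC ler_pdivrMr// mulrAC ler_pdivlMr//.
  rewrite -mulrA ler_pM2l// HE -exprSr; exact: xQ.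
have e2 : `|y| * path_block_error p f N <= K2 / N%:R.
  rewrite ler_pdivlMr//; apply: le_trans HK.
  by rewrite exprSr mulrAC ler_wpM2r// ler_wpM2r// ltW.
have -> : (2 + K2) / N%:R = 2 / N%:R + K2 / N%:R by ring.
exact: lerD.
Qed.

(** The scale is discrete because the random estimates are available for
    integers [N] only. *)
Definition wave_decay := exists2 K : R, 0 <= K & forall l c x y,
  l.+1%:R ^+ Q <= Num.max `|x| `|y| -> Num.max `|x| `|y| <= l.+2%:R ^+ Q ->
  `|wave c x y| <= K / l.+1%:R.

Lemma wave_decay_of_bounds (K1 K2 : R) :
  (forall l b i i', (b < 4)%N -> (i < lattice_size Q l.+1)%N ->
    (i' < lattice_size Q l.+1)%N -> high R q Q l.+1 i' ->
  \int[mu]_(t in `[0, 1]) cos (phase R b + lattice R Q l.+1 i * t + lattice R Q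
      l.+1 i' * f t)
    <= K1 / l.+1%:R) ->
  (forall l, l.+1%:R ^+ p.+1 * path_block_error p f l.+1 <= K2) -> wave_decay.
Proof.
move=> H1 H2.
have [M fM] : exists M, forall t, 0 <= t <= 1 -> `|f t| <= M.
  have cn : {within `[0, 1], continuous (fun t : R => `|f t|)}.
    by apply: continuous_subspaceT => t; apply: cvg_norm; exact: cf.
  have [z _ zM] := EVT_max (ler01 : (0 : R) <= 1) cn.
  by exists `|f z| => t t01; apply: zM; rewrite in_itv.
exists (`|2 * (K1 + 1 + M)| + `|2 + K2|); first exact: addr_ge0.
move=> l c x y; rewrite le_max ge_max => xy /andP[xQ yQ].
have NR : (0 : R) < l.+1%:R by rewrite ltr0n.
have [yp|yp] := leP (l.+1%:R ^+ p) `|y|.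
  apply: le_trans (high_wave_le fM (H1 l) xQ yQ yp c) _.
  rewrite ler_pM2r ?invr_gt0//; apply: le_trans (ler_norm _) _.
  by rewrite lerDl.
apply: le_trans (low_wave_le c (H2 l) _ (ltW yp)) _.
  (* [|y|] is below [N ^ p], so the maximum is attained by [|x|]. *)
  case/orP: xy => // yQ'; exfalso.
  have : l.+1%:R ^+ p <= l.+1%:R ^+ Q :> R.
    by rewrite ler_weXn2l ?ler1n// /Q; lia.
  by move/(le_trans)/(_ yQ'); rewrite leNgt yp.
rewrite ler_pM2r ?invr_gt0//; apply: le_trans (ler_norm _) _.
by rewrite lerDr.
Qed.

End oscillatory_integral.

(** * The measure on the graph and its Fourier transform *)

Section graph_measure.
Context {R : realType}.
Notation mu := (@lebesgue_measure R).
Notation lambda01 := (uniform_prob (@ltr01 R)).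

(** Adding [1] makes the function nonnegative. *)
Lemma Rintegral_uniform01 (h : R -> R) : continuous h -> (forall t, `|h t| <= 1)
    ->
  \int[lambda01]_t h t = \int[mu]_(t in `[0, 1]) h t.
Proof.
move=> ch h1.
have mh : measurable_fun setT (h : measurableTypeR R -> R) by exact:
    continuous_measurable_fun.
have mh1 : measurable_fun setT (EFin \o (fun t => 1 + h t) : measurableTypeR R
    -> \bar R).
  by apply/measurable_EFinP; exact: measurable_funD.
have h0 (t : R) : (0 <= (1 + h t)%:E)%E.
  by rewrite lee_fin; have := h1 t; rewrite ler_norml; lra.
have := integral_uniform (@ltr01 R) mh1 h0 => /(congr1 fine).
have ih := bounded_integrable lambda01 mh h1.
have i1 : (lambda01 : {measure set _ -> \bar R}).-integrable setT (EFin \o (fun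
    _ : R => 1 : R)).
  by apply: (@bounded_integrable _ _ _ _ _ 1) => // t; rewrite normr1.
rewrite subr0 invr1 mul1e => H.
have : \int[lambda01]_t (1 + h t) = \int[mu]_(t in `[0, 1]) (1 + h t) by exact:
    H.
rewrite RintegralD// Rintegral_cst_prob RintegralD//; last 2 first.
- exact: (@continuous_integrable R (fun=> 1) 0 1 (@cst_continuous _ _ _)).
- exact: continuous_integrable.
by rewrite Rintegral_cst_itv// subr0 mul1r => /addrI.
Qed.

Variables (f : R -> R) (a h x0 : R).
Hypotheses (cf : continuous f) (h0 : 0 < h).

Definition graph_point (t : R) : R * R := (a + h * t, x0 + f t).

Lemma measurable_graph_point : measurable_fun setT (graph_point :
    measurableTypeR R -> R * R).
Proof.
apply: measurable_fun_pair; apply: continuous_measurable_fun => t.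
  by apply: cvgD; [exact: cvg_cst|apply: cvgM; [exact: cvg_cst|exact: cvg_id]].
by apply: cvgD; [exact: cvg_cst|exact: cf].
Qed.

Definition graph_rv : {RV lambda01 >-> (R * R)%type} :=
  HB.pack graph_point (isMeasurableFun.Build _ _ _ _ _ measurable_graph_point).

Definition graph_measure : probability (R * R)%type R := distribution lambda01
    graph_rv.

(** The graph over the segment is measurable, being the zero set of a measurable
    function restricted to a strip, and it has full measure. *)
Lemma graph_measure_negligible (E : set (R * R)) :
  (forall t, 0 <= t <= 1 -> E (graph_point t)) -> graph_measure.-negligible (~`
      E).
Proof.
move=> HE.
(* The parameter of the point of the graph above the first coordinate. *)
pose s (z : R * R) := (z.1 - a) / h.
have ms : measurable_fun setT s.
  apply: measurable_funM => //; apply: measurable_funB => //;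
      exact: measurable_fst.
pose k (z : R * R) := z.2 - (x0 + f (s z)).
have mk : measurable_fun setT k.
  apply: measurable_funB; first exact: measurable_snd.
  apply: measurable_funD => //; apply: measurableT_comp ms.
  exact: continuous_measurable_fun.
pose B := (s @^-1` `[0, 1]%classic) `&` (k @^-1` [set 0]).
have mB : measurable B.
  apply: measurableI.
    by rewrite -[X in measurable X]setTI; apply: ms.
  by rewrite -[X in measurable X]setTI; apply: mk.
exists (~` B); split.
- exact: measurableC.
- have -> : graph_measure (~` B) = (1 - graph_measure B)%E by exact:
    probability_setC.
  have -> : graph_measure B = 1%E; last by rewrite subee.
  have BE : graph_rv @^-1` B = `[0, 1]%classic.
    have sg t : s (graph_point t) = t by rewrite /s /graph_point/=; field;
        rewrite gt_eqF.
    apply/seteqP; split => t; rewrite /B /= /k sg/=.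
      by case.
    by move=> ?; split => //; rewrite subrr.
  have -> : graph_measure B = lambda01 `[0, 1]%classic by rewrite -BE.
  by rewrite /uniform_prob integral_uniform_pdf1.
- apply: subsetC => z [/= sz kz].
  have -> : z = graph_point (s z).
    rewrite /graph_point [LHS]surjective_pairing; congr (_, _).
      by rewrite /s; field; rewrite gt_eqF.
    by move/eqP: kz; rewrite subr_eq0 => /eqP.
  by apply: HE; move: sz; rewrite in_itv.
Qed.

Lemma integral_graph_measure (c : R) (xi : R * R) :
  \int[graph_measure]_z cos (c + 2 * pi * dot_product xi z) =
  wave f (2 * pi * (xi.1 * a + xi.2 * x0) + c) (2 * pi * xi.1 * h) (2 * pi *
      xi.2).
Proof.
have mc : measurable_fun setT (fun z : R * R => cos (c + 2 * pi * dot_product xi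
    z)).
  have mdot : measurable_fun setT (dot_product xi).
    by apply: measurable_funD; apply: measurable_funM.
  exact: (measurableT_comp (measurable_cos_affine c (2 * pi)) mdot).
set c' := _ + c; set x := _ * h; set y := 2 * pi * xi.2.
have E t : cos (c + 2 * pi * dot_product xi (graph_point t)) = cos (c' + x * t +
    y * f t).
  by rewrite /c' /x /y /dot_product/=; congr cos; ring.
rewrite /wave -Rintegral_uniform01; last 2 first.
- exact: continuous_wave.
- by move=> t; exact: cos_max.
congr fine; rewrite integral_distribution.
- by apply: eq_integral => t _ /=; rewrite E.
- exact/measurable_EFinP.
- apply: (@bounded_integrable _ _ _ _ _ 1).
    by apply: (measurableT_comp mc); exact: measurable_graph_point.
  by move=> t; exact: cos_max.
Qed.

Lemma normc_le (u v : R) : ComplexField.Normc.normc (Complex u v) <= `|u| +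
    `|v|.
Proof.
rewrite /ComplexField.Normc.normc -[leRHS]ger0_norm ?addr_ge0// -sqrtr_sqr.
rewrite ler_wsqrtr// -(real_normK (num_real u)) -(real_normK (num_real v)).
have := normr_ge0 u; have := normr_ge0 v; nra.
Qed.

Lemma norm_fourier_graph_measure_le (K : R) (xi : R * R) :
  (forall c, `|wave f c (2 * pi * xi.1 * h) (2 * pi * xi.2)| <= K) ->
  ComplexField.Normc.normc (fourier_transform graph_measure xi) <= 2 * K.
Proof.
move=> HK; apply: le_trans (normc_le _ _) _; rewrite normrN.
have -> : 2 * K = K + K by ring.
apply: lerD.
  rewrite (_ : \int[graph_measure]_z cos (2 * pi * dot_product xi z) =
     \int[graph_measure]_z cos (0 + 2 * pi * dot_product xi z)).
    by rewrite integral_graph_measure.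
  by apply: eq_Rintegral => z _; rewrite add0r.
rewrite (_ : \int[graph_measure]_z sin (2 * pi * dot_product xi z) =
   \int[graph_measure]_z cos (- (pi / 2) + 2 * pi * dot_product xi z)).
  by rewrite integral_graph_measure.
by apply: eq_Rintegral => z _; rewrite addrC cosBpihalf.
Qed.

Lemma norm_wave_le1 c x y : `|wave f c x y| <= 1.
Proof.
rewrite -[leRHS]mulr1 -[X in _ <= _ * X](subr0 1);
    apply: le_norm_Rintegral_itv => //.
  exact: continuous_wave.
by move=> t _; exact: cos_max.
Qed.

Lemma ex_power_bracket (Q : nat) (n : R) : (0 < Q)%N -> 1 <= n ->
  exists l : nat, l.+1%:R ^+ Q <= n <= l.+2%:R ^+ Q.
Proof.
move=> Q0 n1; have n0 : 0 <= n by lra.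
pose r := n `^ Q%:R^-1.
have rE : r ^+ Q = n.
  rewrite -powR_mulrn ?powR_ge0// /r -powRrM mulVf ?powRr1//.
  by rewrite pnatr_eq0 -lt0n.
have r1 : 1 <= r.
  have -> : 1 = 1 `^ Q%:R^-1 :> R by rewrite powR1.
  by apply: ge0_ler_powR; rewrite ?nnegrE ?invr_ge0.
have r0 : 0 <= r by lra.
have /andP[t0 t1] := truncn_itv r0.
have tp : (0 < Num.truncn r)%N by rewrite truncn_gt0.
exists (Num.truncn r).-1; rewrite prednK//; clearbody r; rewrite -rE.
by rewrite !lerXn2r ?nnegrE// ltW.
Qed.

(** The frequency seen by [wave] is comparable with [xi], and the bound [K / N]
    at size [N ^ Q] means decay of exponent [1 / Q]. *)
Lemma fourier_decay_graph (q : nat) (E : set (R * R)) :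
  (forall t, 0 <= t <= 1 -> E (graph_point t)) -> wave_decay f q ->
  exists2 alpha : R, 0 < alpha & fourier_decay E alpha.
Proof.
move=> HE [K K0 HK]; set Q := (2 * _).+1 in HK.
have QR : (0 : R) < Q%:R by rewrite ltr0n.
exists (2 / Q%:R); first by rewrite divr_gt0.
exists graph_measure.
  split; last exact: graph_measure_negligible.
  by rewrite [X in X != _]probability_setT.
have -> : - (2 / Q%:R / 2) = - Q%:R^-1 :> R by field; rewrite gt_eqF.
have pi0 := @pi_gt0 R.
(* The Euclidean norm of [xi] is at most [c1] times the larger of [|x|] and
   [|y|]. *)
pose c1 : R := (2 * pi * h)^-1 + (2 * pi)^-1.
have ph0 : 0 < 2 * pi * h by rewrite !mulr_gt0.
have p0 : 0 < 2 * pi :> R by rewrite mulr_gt0.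
have c10 : 0 < c1 by rewrite addr_gt0 ?invr_gt0.
pose C1 := c1 `^ Q%:R^-1.
have C10 : 0 < C1 by exact: powR_gt0.
exists (2 * C1 + 4 * K * C1) => xi xi0.
set x := 2 * pi * xi.1 * h; set y := 2 * pi * xi.2.
set n := Num.max `|x| `|y|; set e := euclidean_norm xi.
have en : e <= n * c1.
  have : e <= `|xi.1| + `|xi.2|.
    rewrite /e /euclidean_norm; exact: (normc_le xi.1 xi.2).
  move/le_trans; apply; rewrite /c1 mulrDr; apply: lerD.
    rewrite ler_pdivlMr//; apply: (@le_trans _ _ `|x|);
        last by rewrite le_max lexx.
    by rewrite /x !normrM (gtr0_norm pi0) (gtr0_norm h0) ger0_norm//; lra.
  rewrite ler_pdivlMr//; apply: (@le_trans _ _ `|y|);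
      last by rewrite le_max lexx orbT.
  by rewrite /y !normrM (gtr0_norm pi0) ger0_norm//; lra.
have e0 : 0 < e.
  rewrite /e /euclidean_norm sqrtr_gt0.
  move: xi0; rewrite -pair_eqE/= negb_and => /orP[|] h1.
    by rewrite ltr_pwDl ?sqr_ge0// lt_def sqrf_eq0 h1 sqr_ge0.
  by rewrite ltr_wpDl ?sqr_ge0// lt_def sqrf_eq0 h1 sqr_ge0.
have eQ : 0 < e `^ Q%:R^-1 by exact: powR_gt0.
rewrite powRN ler_pdivlMr//.
have n0 : 0 <= n by rewrite le_max normr_ge0.
have [n1|n1] := leP 1 n; last first.
  have le1 : e `^ Q%:R^-1 <= C1.
    apply: ge0_ler_powR; rewrite ?nnegrE ?invr_ge0 ?(ltW e0) ?(ltW c10)//.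
    by apply: (le_trans en); rewrite ler_piMl// ltW.
  have := norm_fourier_graph_measure_le (fun c => norm_wave_le1 c x y).
  rewrite mulr1 => h1; apply: (@le_trans _ _ (2 * C1)).
    by apply: ler_pM => //; [exact: sqrtr_ge0|exact: ltW].
  by rewrite lerDl !mulr_ge0// ltW.
have [l /andP[l1 l2]] := @ex_power_bracket Q n isT n1.
have := norm_fourier_graph_measure_le (fun c => HK l c x y l1 l2) => h1.
have LR : (0 : R) < l.+1%:R by rewrite ltr0n.
have le1 : e `^ Q%:R^-1 <= C1 * (2 * l.+1%:R).
  have -> : C1 * (2 * l.+1%:R) = (c1 * (2 * l.+1%:R) ^+ Q) `^ Q%:R^-1.
    rewrite powRM ?exprn_ge0 ?mulr_ge0 ?(ltW c10)// -powR_mulrn ?mulr_ge0//.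
    by rewrite -powRrM divff ?gt_eqF// powRr1// mulr_ge0.
  apply: ge0_ler_powR; rewrite ?nnegrE ?invr_ge0 ?(ltW e0)//.
    by rewrite mulr_ge0 ?(ltW c10)// exprn_ge0// mulr_ge0.
  apply: (le_trans en); rewrite mulrC ler_pM2l//; apply: (le_trans l2).
  by rewrite lerXn2r ?nnegrE ?mulr_ge0// -natrM ler_nat mul2n -addnn addnS addSn
      !ltnS leq_addr.
apply: (@le_trans _ _ (2 * (K / l.+1%:R) * (C1 * (2 * l.+1%:R)))).
  by apply: ler_pM => //; [exact: sqrtr_ge0|exact: ltW].
have -> : 2 * (K / l.+1%:R) * (C1 * (2 * l.+1%:R)) = 4 * K * C1.
  by field; rewrite addrC natr1 pnatr_eq0.
by rewrite lerDr mulr_ge0// ltW.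
Qed.

Lemma fourier_dim_gt0 (q : nat) (E : set (R * R)) :
  (forall t, 0 <= t <= 1 -> E (graph_point t)) -> wave_decay f q ->
  (0 < fourier_dim E)%E.
Proof.
move=> HE Hw; have [alpha a0 Ha] := fourier_decay_graph HE Hw.
apply: (@lt_le_trans _ _ alpha%:E); first by rewrite lte_fin.
by apply: ereal_sup_ubound; exists alpha => //; split => //; exact: ltW.
Qed.

End graph_measure.

(** * From additive processes to Gaussian increments *)

Section gaussian_graph.
Context d (Omega : measurableType d) (R : realType) (P : probability Omega R).

(** The two bounds are used with [p = 2 q + 1] and [Q = 2 (p + 3) + 1], for
    which their ranges cover all frequencies. *)
Lemma gaussian_wave_decay (Y : R -> Omega -> R) (v : R -> R) (kappa : R) (q :
    nat) :
  gaussian_increments P Y v -> 0 < kappa ->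
  (forall s t, 0 <= s -> s < t -> t <= 1 -> kappa * (t - s) ^+ q <= v t - v s)
      ->
  {ae P, forall w, continuous (Y ^~ w)} ->
  {ae P, forall w, continuous (Y ^~ w) /\ wave_decay (Y ^~ w) q}.
Proof.
move=> GY kappa0 vq cY.
have H1 := high_frequency_bound (2 * ((2 * q).+1 + 3)).+1 GY kappa0 vq.
have H2 := low_frequency_bound (2 * q).+1 GY.
apply: filterS3 cY H1 H2 => w cw /(_ cw)[K1 HK1] /(_ cw)[K2 HK2].
split=> //; exact: (wave_decay_of_bounds cw HK1 HK2).
Qed.

Lemma ae_eq_probability (U W : Omega -> R) (A : set R) :
  measurable_fun setT U -> measurable_fun setT W -> measurable A ->
  {ae P, forall w, U w = W w} -> P (U @^-1` A) = P (W @^-1` A).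
Proof.
move=> mU mW mA UW.
have mUA : measurable (U @^-1` A) by rewrite -[X in measurable X]setTI;
    exact: mU.
have mWA : measurable (W @^-1` A) by rewrite -[X in measurable X]setTI;
    exact: mW.
have := @integral_indic _ _ _ P setT measurableT _ mUA; rewrite setIT => <-.
have := @integral_indic _ _ _ P setT measurableT _ mWA; rewrite setIT => <-.
apply: ae_eq_integral => //.
- by apply/measurable_EFinP; exact: measurable_indic.
- by apply/measurable_EFinP; exact: measurable_indic.
apply: filterS UW => w UWw _; rewrite !indicE; congr ((_%:R)%:E).
by apply: congr1; apply/idP/idP; rewrite !inE /= UWw.
Qed.

End gaussian_graph.

Section time_change.
Context {R : realType}.
Implicit Types (S : \bar R) (V T : R -> R).

Lemma time_setP S t t' : time_set S t' -> 0 <= t -> t <= t' -> time_set S t.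
Proof.
by move=> [_ t'S] t0 tt'; split => //; apply: le_trans t'S; rewrite lee_fin.
Qed.

(** A positive index provides an exponent for which the quotients tend to zero,
    hence are eventually at most [1]. *)
Lemma holder_index_gt0 (F : R -> R) (L : set R) (s : R) :
  (0 < upper_local_uniform_holder_index F L s)%E ->
  exists alpha delta : R, [/\ 0 < alpha, 0 < delta & forall u1 u2,
    `|u1 - s| < delta -> `|u2 - s| < delta -> L u1 -> L u2 ->
    `|F u1 - F u2| <= `|u1 - u2| `^ alpha].
Proof.
move=> /ereal_sup_gt[_ [alpha [a0 ah] <-]]; rewrite lte_fin => alpha0.
have : \forall delta \near 0^'+, (holder_quotient_sup F L s alpha delta <
    1%:E)%E.
  have /(_ [set y | (y < 1%:E)%E]) := ah; apply.
  apply: open_nbhs_nbhs; split; first exact: open_ereal_lt_ereal.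
  by rewrite /= lte_fin.
move=> H; have [delta [d0 Hd]] : exists delta : R, 0 < delta /\
    (holder_quotient_sup F L s alpha delta < 1%:E)%E.
  apply: (@filter_ex _ (0^'+ : set_system R)); near=> delta; split.
    by near: delta; exact: nbhs_right_gt.
  by near: delta.
exists alpha, (delta / 2); split => //; first exact: divr_gt0.
move=> u1 u2 h1 h2 L1 L2.
have [->|u12] := eqVneq u1 u2; first by rewrite subrr normr0 powR_ge0.
have u0 : 0 < `|u1 - u2| `^ alpha by rewrite powR_gt0// normr_gt0 subr_eq0.
rewrite -[leRHS]mul1r -ler_pdivrMr// -lee_fin; apply: le_trans (ltW Hd).
apply: ereal_sup_ubound; exists u1, u2; split => //.
  by move: h1; rewrite in_itv/= ltr_norml; lra.
by move: h2; rewrite in_itv/= ltr_norml; lra.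
Unshelve. all: by end_near.
Qed.

Lemma within_continuous_dist (S : \bar R) V t0 e : {within time_set S,
    continuous V} ->
  time_set S t0 -> 0 < e ->
  exists2 eta : R, 0 < eta & forall t, time_set S t -> `|t - t0| < eta -> `|V t
      - V t0| < e.
Proof.
move=> /subspace_continuousP cV Jt0 e0.
have /cvgrPdist_lt /(_ e e0) := cV t0 Jt0.
rewrite /within/= => /nbhs_ballP[eta /= eta0 H].
exists eta => // t Jt tt0; rewrite distrC; apply: H => //.
by rewrite /ball/= distrC.
Qed.

(** The segment starts at [t0], or ends there when [t0] is the last time. *)
Lemma time_set_segment (S : \bar R) (t0 eta : R) : (0 < S)%E -> time_set S t0 ->
    0 < eta ->
  exists a h : R, [/\ 0 < h, h <= 1, 0 <= a, time_set S (a + h) &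
    forall t, a <= t <= a + h -> `|t - t0| < eta].
Proof.
move=> S0 [t00 t0S] eta0.
have [|t0S'] := boolP (t0%:E < S)%E.
  move=> t0S'.
  have [r r0 rS] : exists2 r : R, 0 < r & ((t0 + r)%:E <= S)%E.
    case: S S0 t0S t0S' => [S| |] //= _ _ => [|_].
      by rewrite lte_fin => h; exists (S - t0); rewrite ?subr_gt0// addrC subrK.
    by exists 1 => //; rewrite leey.
  pose h := Num.min 1 (Num.min r (eta / 2)).
  have h0 : 0 < h by rewrite !lt_min ltr01 r0 divr_gt0.
  have hr : h <= r by rewrite !ge_min lexx orbT.
  have he : h <= eta / 2 by rewrite !ge_min lexx !orbT.
  exists t0, h; split => //; first by rewrite ge_min lexx.
    split; first by rewrite addr_ge0// ltW.
    by apply: le_trans rS; rewrite lee_fin lerD2l.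
  by move=> t /andP[t1 t2]; rewrite ltr_norml; apply/andP; split; lra.
have t0E : t0%:E = S by apply/eqP; rewrite eq_le t0S leNgt.
have t0gt : 0 < t0 by rewrite -lte_fin t0E.
pose h := Num.min 1 (Num.min t0 (eta / 2)).
have h0 : 0 < h by rewrite !lt_min ltr01 t0gt divr_gt0.
have hr : h <= t0 by rewrite !ge_min lexx orbT.
have he : h <= eta / 2 by rewrite !ge_min lexx !orbT.
exists (t0 - h), h; split => //.
- by rewrite ge_min lexx.
- by rewrite subr_ge0.
- by rewrite subrK.
- by move=> t /andP[t1 t2]; rewrite ltr_norml; apply/andP; split; lra.
Qed.

(** Stopping the time parameter outside [[0, 1]] makes the rescaled paths
    continuous on the whole line. *)
Definition clamp01 (u : R) : R := Num.max 0 (Num.min u 1).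

Lemma clamp01_itv u : 0 <= clamp01 u <= 1.
Proof. by rewrite /clamp01 le_max lexx/= ge_max ler01/= ge_min lexx orbT. Qed.

Lemma clamp01_id u : 0 <= u <= 1 -> clamp01 u = u.
Proof.
by move=> /andP[u0 u1]; rewrite /clamp01 (min_idPl u1) (max_idPr u0).
Qed.

Lemma continuous_clamp01 : continuous clamp01.
Proof.
have cmin : continuous (fun t : R => Num.min t 1).
  move=> u; have := @continuous_min R R id (fun=> 1) u; apply;
      first exact: cvg_id.
  exact: cvg_cst.
move=> u; have := @continuous_max R R (fun=> 0) (fun t => Num.min t 1) u; apply.
  exact: cvg_cst.
exact: cmin.
Qed.

Lemma within_continuous_comp (J : set R) (g phi : R -> R) :
  {within J, continuous g} -> continuous phi -> (forall u, J (phi u)) ->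
  continuous (g \o phi).
Proof.
move=> /subspace_continuousP cg cphi Jphi u.
apply: cvg_comp (cg _ (Jphi u)).
move=> A; rewrite /within/= => HA.
have := cphi u _ HA; rewrite /fmap/=.
by apply: (@filterS _ (nbhs u)) => z /=; apply; exact: Jphi.
Qed.

End time_change.

Theorem theorem1p3 (R : realType) (d : measure_display)
    (Omega : measurableType d) (P : probability Omega R)
    (S : \bar R) (S_gt0 : (0 < S)%E)
    (X B : R -> {RV P >-> R}) (V T : R -> R)
    (X_additive : continuous_additive_process P (time_set S) X)
    (X_centered : centered_process P (time_set S) X)
    (X_repr : brownian_representation P (time_set S) X V B)
    (V_increasing : {in time_set S &, {homo V : s t / s < t}})
    (T_inverse : {in time_set S, cancel V T})
    (holder_point : exists2 s, (V @` time_set S) s &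
       (0 < upper_local_uniform_holder_index T (V @` time_set S) s)%E) :
  {ae P, forall w,
    (0 < fourier_dim (graph (fun t => X t w) (time_set S)))%E}.
Proof.
have [_ [t0 Jt0 <-] /holder_index_gt0[alpha [delta [alpha0 delta0 holder]]]] :=
    holder_point.
have [eta eta0 Veta] := within_continuous_dist (variance_continuous X_repr) Jt0
    delta0.
have [a [h [h0 h1 a0 Jah near_t0]]] := time_set_segment S_gt0 Jt0 eta0.
have Jitv t : a <= t <= a + h -> time_set S t.
  by move=> /andP[at_ tah]; apply: time_setP Jah _ tah; exact: le_trans at_.
pose time u := a + h * clamp01 u.
have time_itv u : a <= time u <= a + h.
  have /andP[c0 c1] := clamp01_itv u.
  by rewrite /time lerDl mulr_ge0 ?(ltW h0)//= lerD2l ler_piMr// ltW.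
have Jtime u : time_set S (time u) by apply: Jitv.
have timeE u : 0 <= u <= 1 -> time u = a + h * u by move=> u01;
    rewrite /time clamp01_id.
have c_time : continuous time.
  move=> u; apply: cvgD; first exact: cvg_cst.
  by apply: cvgM; [exact: cvg_cst|exact: continuous_clamp01].
have time0 : time 0 = a by rewrite timeE ?lexx ?ler01// mulr0 addr0.
pose Y u w := X (time u) w - X a w.
pose v u := V (time u).
(* Inverting the Holder bound gives growth of exponent [1 / alpha]; lengths are
   at most [1], so any larger integer exponent will do. *)
pose q := (Num.truncn alpha^-1).+1.
have inc s t : 0 <= s -> s < t -> t <= 1 -> time s < time t.
  move=> s0 st t1; rewrite !timeE ?(ltW st) ?s0 ?t1 ?(le_trans s0 (ltW st))
      ?(le_trans (ltW st) t1)//.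
  by rewrite ltrD2l ltr_pM2l.
have vinc s t : 0 <= s -> s < t -> t <= 1 -> v s < v t.
  by move=> s0 st t1; apply: V_increasing; rewrite ?inE//; exact: inc.
have vq s t : 0 <= s -> s < t -> t <= 1 -> h ^+ q * (t - s) ^+ q <= v t - v s.
  move=> s0 st t1.
  have := holder (v t) (v s).
  have hv u : `|v u - V t0| < delta by apply: Veta => //; exact: near_t0.
  move=> /(_ (hv t) (hv s)).
  have Lv u : (V @` time_set S) (v u) by exists (time u).
  move=> /(_ (Lv t) (Lv s)); rewrite /v !T_inverse ?inE// -/(v t) -/(v s).
  have -> : time t - time s = h * (t - s).
    rewrite !timeE ?(ltW st) ?s0 ?t1 ?(le_trans s0 (ltW st)) ?(le_trans (ltW st)
        t1)//; ring.
  have vst : 0 < v t - v s by rewrite subr_gt0 vinc.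
  have hts : 0 < h * (t - s) by rewrite mulr_gt0 ?subr_gt0.
  rewrite !gtr0_norm// => H; rewrite -exprMn.
  have H' : (h * (t - s)) `^ alpha^-1 <= v t - v s.
    apply: (@le_trans _ _ (((v t - v s) `^ alpha) `^ alpha^-1)).
      by apply: ge0_ler_powR; rewrite ?nnegrE ?invr_ge0 ?powR_ge0 ?(ltW alpha0)
          ?(ltW hts).
    by rewrite -powRrM divff ?gt_eqF// powRr1// ltW.
  apply: le_trans H'; rewrite -powR_mulrn ?(ltW hts)//.
  have hts1 : h * (t - s) <= 1 by rewrite mulr_ile1 ?(ltW h0)//; lra.
  by apply: ger_powR; rewrite ?hts ?hts1//; apply/ltW; exact: truncnS_gt.
have GY : gaussian_increments P Y v.
  (* Increments of [Y] are increments of [X]: the value at time [a] cancels. *)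
  have YE s t : (fun w => Y t w - Y s w) = (fun w => X (time t) w - X (time s)
      w).
    by apply/funext => w; rewrite /Y; ring.
  split.
  - by move=> t; apply: measurable_funB.
  - by move=> w; rewrite /Y time0 subrr.
  - move=> n t t01 tm.
    have -> : (fun (i : 'I_n) w => Y (t i.+1) w - Y (t i) w) =
        (fun (i : 'I_n) w => X (time (t i.+1)) w - X (time (t i)) w).
      by apply/funext => i; rewrite YE.
    apply: (additive_indep (continuous_additive X_additive) (t := fun i => time
        (t i))) => //.
    move=> i iN; have := tm i iN; rewrite le_eqVlt => /predU1P[->//|st].
    have /andP[s0 _] := t01 i (ltnW iN); have /andP[_ s1] := t01 _ iN.
    by apply/ltW/inc.
  - move=> s t s0 st t1; split; first exact: vinc.
    move=> A mA; rewrite YE.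
    have Bm := represented_brownian X_repr.
    rewrite -(brownian_increment Bm (s := v s) (t := v t)) ?vinc//;
        last 2 first.
    + by exists (time s).
    + by exists (time t).
    apply: ae_eq_probability => //.
    + exact: measurable_funB.
    + exact: measurable_funB.
    apply: filterS2 (represented_eq X_repr (Jtime t)) (represented_eq X_repr
        (Jtime s)).
    by move=> w -> ->.
have cY : {ae P, forall w, continuous (Y ^~ w)}.
  apply: filterS (continuous_additive_paths X_additive) => w cX u.
  apply: cvgB; last exact: cvg_cst.
  exact: (within_continuous_comp cX c_time Jtime).
apply: filterS (gaussian_wave_decay GY (exprn_gt0 q h0) vq cY) => w [cw decay].
apply: (fourier_dim_gt0 (a := a) (x0 := X a w) cw h0 _ decay) => t t01.
exists (a + h * t); first by rewrite -timeE.
by rewrite /graph_point /Y timeE// [X a w + _]addrC subrK.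
Qed.
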